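(* Let $f(z)=z+\sum_{n=2}^{\infty}a_nz^n$ belong to $\mathcal{S}^*_{ch}$, and let $\Gamma_1=-\frac12a_2$ and $\Gamma_2=-\frac12\big(a_3-\frac32a_2^2\big)$ be its first two logarithmic inverse coefficients. Then $$-\frac{1}{\sqrt{10}}\le |\Gamma_2|-|\Gamma_1|\le\frac14.$$ Both inequalities are sharp (each bound is attained by some function in $\mathcal{S}^*_{ch}$).
   Context: $\mathbb{D}=\{z\in\mathbb{C}:|z|<1\}$. $\mathcal{A}$ is the class of analytic $f$ on $\mathbb{D}$ with $f(0)=0$, $f'(0)=1$. For analytic $g,h$ on $\mathbb{D}$, $g\prec h$ means there is an analytic $\omega$ on $\mathbb{D}$ with $\omega(0)=0$, $|\omega(z)|<1$, and $g=h\circ\omega$. $\mathcal{S}^*_{ch}$ is the class of $f\in\mathcal{A}$ with $\frac{zf'(z)}{f(z)}\prec z+\cosh z$ on $\mathbb{D}$. Logarithmic inverse coefficients $\Gamma_n$ are defined by $\log\frac{f^{-1}(w)}{w}=2\sum_{n\ge1}\Gamma_nw^n$ for $w$ near $0$. *)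

(* Defs.v *)
From Stdlib Require Import Reals.
From Coquelicot Require Import Coquelicot.
Open Scope R_scope.

Definition in_disc (z : C) : Prop := (Cmod z < 1)%R.

Fixpoint cpow (z : C) (n : nat) : C :=
  match n with O => RtoC 1 | S k => Cmult z (cpow z k) end.

Definition cexp (w : C) : C :=
  (exp (fst w) * cos (snd w), exp (fst w) * sin (snd w)).
Definition ccosh (w : C) : C :=
  Cmult (Cplus (cexp w) (cexp (Copp w))) (RtoC (/ 2)).

Definition has_cderiv (g : C -> C) (z l : C) : Prop :=
  @is_derive C_AbsRing C_NormedModule g z l.

Definition analytic_on_disc (g : C -> C) : Prop :=
  forall z, in_disc z -> exists l, has_cderiv g z l.

Definition in_A_with_coeffs (f : C -> C) (a : nat -> C) : Prop :=
  a 0%nat = RtoC 0 /\ a 1%nat = RtoC 1 /\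
  forall z, in_disc z -> is_series (fun n => Cmult (a n) (cpow z n)) (f z).

Definition subordinate (g h : C -> C) : Prop :=
  exists w : C -> C, analytic_on_disc w /\ w (RtoC 0) = RtoC 0 /\
    (forall z, in_disc z -> (Cmod (w z) < 1)%R) /\
    (forall z, in_disc z -> g z = h (w z)).

Definition phi_ch (z : C) : C := Cplus z (ccosh z).

(* The class S*_ch: z f'(z)/f(z) ≺ z + cosh z.  The quotient z f'/f is
   taken on D \ {0} (where f must not vanish) and extended to 0 by its
   limit value f'(0)=1 (a removable singularity since f(0)=0, f'(0)=1). *)
Definition Sch_quotient (f : C -> C) (z : C) : C :=
  if Req_EM_T (Cmod z) 0 then RtoC 1
  else Cdiv (Cmult z (C_derive f z)) (f z).

Definition in_Sstar_ch (f : C -> C) (a : nat -> C) : Prop :=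
  in_A_with_coeffs f a /\
  (forall z, in_disc z -> z <> RtoC 0 -> f z <> RtoC 0) /\
  subordinate (Sch_quotient f) phi_ch.

Definition Gamma1 (a : nat -> C) : C := Cmult (RtoC (- / 2)) (a 2%nat).
Definition Gamma2 (a : nat -> C) : C :=
  Cmult (RtoC (- / 2))
    (Cminus (a 3%nat) (Cmult (RtoC (3 / 2)) (Cmult (a 2%nat) (a 2%nat)))).

(* Main.v *)
Require Import Defs.
From Stdlib Require Import Reals Lra Lia Classical ClassicalEpsilon.
From Coquelicot Require Import Coquelicot.
Open Scope R_scope.

(** Let [w = c1 z + c2 z^2 + ...] be the Schwarz function with [z f' / f = phi_ch w].
    Since [phi_ch u = 1 + u + u^2 / 2 + ...], comparing coefficients gives [c1 = a2] and
    [c2 = 2 a3 - (3/2) a2^2], so [Gamma1 = - c1 / 2] and [Gamma2 = - (c2 - (3/2) c1^2) / 4].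
    Both bounds follow from [|c2| <= 1 - |c1|^2] and the triangle inequality.

    That inequality comes from averaging [w (1 + y z)^2 / z^2], whose mean over small circles
    is [c2 + 2 y c1], against the mean [1 + |y|^2 r^2] of [|1 + y z|^2]; the mean value
    property rests on Goursat's theorem for rectangles, in the coordinate [log z].

    Equality holds for [w = z (z + c) / (1 + c z)], with [c = 0] for the upper bound and
    [c = 2 / sqrt 10] for the lower one; [f] is then recovered as [z exp (int_0^z (phi_ch w - 1) / t dt)],
    expanded in a power series by solving linear differential equations for the coefficients. *)

(** * Complex derivatives *)

(** Analyticity means complex differentiability at each point, with no continuity of the derivative,
    and the Schwarz function [w] comes without a power series. This is why Goursat's subdivision is
    used rather than Green's formula, and why [c2] enters as the limit of [(w z - c1 * z) / (z * z)]
    at the origin, computed from the series of [f]. In the averaging, [c1 / z] has mean zero on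
    circles; subtracting it makes the limit at the puncture finite.

    The constants come from a problem in one real variable. With [x = |c1|], so that
    [|Gamma1| = x / 2], the coefficient inequality gives [4 |Gamma2| <= 1 + x^2 / 2] and
    [4 |Gamma2| >= max (0, 5 x^2 / 2 - 1)]. The lower estimate minus [x / 2] decreases until
    [5 x^2 / 2 = 1], that is [x = 2 / sqrt 10], and increases afterwards; its minimum is
    [- 1 / sqrt 10]. The upper estimate minus [x / 2] is largest at [x = 0]. The parameter [c] of
    each extremal function is the corresponding value of [x]. *)

Lemma has_cderiv_iff (g : C -> C) (z l : C) :
  has_cderiv g z l <->
  (forall eps : R, 0 < eps -> exists d : R, 0 < d /\ forall y : C,
     Cmod (y - z) < d ->
     Cmod (g y - g z - (y - z) * l) <= eps * Cmod (y - z)).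
Proof.
split.
- intros [_ H] eps He.
  assert (Hz : @is_filter_lim (AbsRing_NormedModule C_AbsRing)
    (@locally (AbsRing_NormedModule C_AbsRing) z) z) by (intros P HP; exact HP).
  destruct (H z Hz (mkposreal eps He)) as [d Hd].
  exists d; split; [apply cond_pos|].
  intros y Hy; exact (Hd y Hy).
- intros H; split; [apply is_linear_scal_l|].
  intros x Hx eps.
  replace x with z by
    (exact (@is_filter_lim_locally_unique C_AbsRing (AbsRing_NormedModule C_AbsRing) z x Hx)).
  destruct (H eps (cond_pos eps)) as [d [Hd1 Hd]].
  exists (mkposreal d Hd1); intros y Hy; exact (Hd y Hy).
Qed.

(** The complex field carries two normed-module structures over itself, and the product and chain
    rules are stated for [AbsRing_NormedModule C_AbsRing]. The remainder conditions are convertible,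
    so only linearity has to be supplied anew. *)
Lemma has_cderiv_AbsRing (g : C -> C) (z l : C) :
  has_cderiv g z l <->
  @is_derive C_AbsRing (AbsRing_NormedModule C_AbsRing) g z l.
Proof.
split; intros [_ H]; (split; [apply is_linear_scal_l|exact H]).
Qed.

Lemma has_cderiv_ext_loc (f g : C -> C) (z l : C) (d : R) :
  0 < d -> (forall y : C, Cmod (y - z) < d -> f y = g y) ->
  has_cderiv f z l -> has_cderiv g z l.
Proof.
intros Hd E H; apply (is_derive_ext_loc f); [|exact H].
exists (mkposreal d Hd); intros y Hy; exact (E y Hy).
Qed.

Lemma has_cderiv_eq (f : C -> C) (z l l' : C) :
  has_cderiv f z l -> l = l' -> has_cderiv f z l'.
Proof. now intros H <-. Qed.

Lemma has_cderiv_const (c z : C) : has_cderiv (fun _ => c) z 0.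
Proof. apply has_cderiv_AbsRing.
exact (is_derive_const (V := AbsRing_NormedModule C_AbsRing) c z). Qed.

Lemma has_cderiv_id (z : C) : has_cderiv (fun x => x) z 1.
Proof. apply has_cderiv_AbsRing.
exact (is_derive_id (K := C_AbsRing) z). Qed.

Lemma has_cderiv_plus (f g : C -> C) (z lf lg : C) :
  has_cderiv f z lf -> has_cderiv g z lg ->
  has_cderiv (fun x => f x + g x)%C z (lf + lg)%C.
Proof.
rewrite !has_cderiv_AbsRing; intros Hf Hg.
exact (is_derive_plus (V := AbsRing_NormedModule C_AbsRing) f g z lf lg Hf Hg).
Qed.

Lemma has_cderiv_mult (f g : C -> C) (z lf lg : C) :
  has_cderiv f z lf -> has_cderiv g z lg ->
  has_cderiv (fun x => f x * g x)%C z (lf * g z + f z * lg)%C.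
Proof.
rewrite !has_cderiv_AbsRing; intros Hf Hg.
exact (is_derive_mult (K := C_AbsRing) f g z lf lg Hf Hg Cmult_comm).
Qed.

Lemma has_cderiv_comp (f g : C -> C) (z lf lg : C) :
  has_cderiv f (g z) lf -> has_cderiv g z lg ->
  has_cderiv (fun x => f (g x)) z (lg * lf)%C.
Proof.
rewrite !has_cderiv_AbsRing; intros Hf Hg.
exact (is_derive_comp (V := AbsRing_NormedModule C_AbsRing) f g z lf lg Hf Hg).
Qed.

Lemma has_cderiv_scal (c : C) (f : C -> C) (z l : C) :
  has_cderiv f z l -> has_cderiv (fun x => c * f x)%C z (c * l)%C.
Proof.
intros H; replace (c * l)%C with (0 * f z + c * l)%C by ring.
apply (has_cderiv_mult (fun _ => c)); [apply has_cderiv_const|exact H].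
Qed.

Lemma has_cderiv_minus (f g : C -> C) (z lf lg : C) :
  has_cderiv f z lf -> has_cderiv g z lg ->
  has_cderiv (fun x => f x - g x)%C z (lf - lg)%C.
Proof.
intros Hf Hg; apply (has_cderiv_ext_loc (fun x => f x + (-(1)) * g x)%C) with (d := 1);
  [lra|intros; ring|].
replace (lf - lg)%C with (lf + (-(1)) * lg)%C by ring.
apply has_cderiv_plus, has_cderiv_scal; assumption.
Qed.

Lemma has_cderiv_inv (z : C) :
  z <> RtoC 0 -> has_cderiv Cinv z (- / (z * z))%C.
Proof.
intros Hz; apply has_cderiv_iff; intros eps He.
assert (Hm : 0 < Cmod z) by now apply Cmod_gt_0.
set (m := Cmod z) in *.
(* The remainder is [(y - z)^2 / (y z^2)]. The first radius keeps [|y| >= m / 2]; the second then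
   gives [|y - z| <= eps * |y| * m^2]. *)
exists (Rmin (m / 2) (eps * m ^ 3 / 2)); split.
{ apply Rmin_case; [lra|].
  assert (0 < m ^ 3) by now apply pow_lt. nra. }
intros y Hy.
assert (H1 : Cmod (y - z) < m / 2) by (eapply Rlt_le_trans; [exact Hy|apply Rmin_l]).
assert (H2 : Cmod (y - z) < eps * m ^ 3 / 2) by (eapply Rlt_le_trans; [exact Hy|apply Rmin_r]).
assert (Hy2 : m / 2 <= Cmod y).
{ assert (T := Cmod_triangle y (z - y)).
  replace (y + (z - y))%C with z in T by ring.
  replace (z - y)%C with (- (y - z))%C in T by ring.
  rewrite Cmod_opp in T; fold m in T; lra. }
assert (Hy0 : y <> RtoC 0).
{ intros E; rewrite E, Cmod_0 in Hy2; lra. }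
replace (/ y - / z - (y - z) * - / (z * z))%C
  with ((y - z) * ((y - z) * / (y * (z * z))))%C by (field; now split).
rewrite !Cmod_mult, Cmod_inv, !Cmod_mult by (repeat apply Cmult_neq_0; assumption).
fold m; rewrite Rmult_comm.
apply Rmult_le_compat_r; [apply Cmod_ge_0|].
assert (Hmm : 0 < m * m) by now apply Rmult_lt_0_compat.
assert (Hp : 0 < Cmod y * (m * m)) by (apply Rmult_lt_0_compat; lra).
apply Rmult_le_reg_r with (Cmod y * (m * m)); trivial.
rewrite Rmult_assoc, Rinv_l by lra.
assert (eps * (m * m) * (m / 2) <= eps * (m * m) * Cmod y).
{ apply Rmult_le_compat_l; [|assumption]. apply Rmult_le_pos; lra. }
lra.
Qed.

(** * The complex exponential and its derivative *)

Lemma cexp_plus (z w : C) : cexp (z + w) = (cexp z * cexp w)%C.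
Proof.
unfold cexp, Cmult, Cplus; simpl.
rewrite exp_plus, cos_plus, sin_plus.
apply injective_projections; simpl; ring.
Qed.

Lemma cexp_0 : cexp 0 = RtoC 1.
Proof.
unfold cexp; simpl; rewrite exp_0, cos_0, sin_0.
apply injective_projections; simpl; ring.
Qed.

Lemma cexp_neq_0 (z : C) : cexp z <> RtoC 0.
Proof.
intros E.
assert (H : (cexp z * cexp (- z))%C = RtoC 1).
{ rewrite <- cexp_plus, <- cexp_0; f_equal; ring. }
rewrite E, Cmult_0_l in H; apply RtoC_inj in H; lra.
Qed.

Lemma Rabs_fst_snd_le_Cmod (z : C) : Rabs (fst z) <= Cmod z /\ Rabs (snd z) <= Cmod z.
Proof.
assert (H := Rmax_Cmod z).
split; eapply Rle_trans; [apply Rmax_l|exact H|apply Rmax_r|exact H].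
Qed.

Lemma Cmod_le_Rabs_fst_snd (z : C) : Cmod z <= Rabs (fst z) + Rabs (snd z).
Proof.
destruct z as [x y]; unfold Cmod; simpl.
apply Rle_trans with (sqrt ((Rabs x + Rabs y) ^ 2)).
- apply sqrt_le_1_alt.
  assert (H := Rabs_pos x); assert (H' := Rabs_pos y).
  assert (X := pow2_abs x); assert (Y := pow2_abs y).
  simpl in *; nra.
- rewrite sqrt_pow2; [lra|].
  assert (H := Rabs_pos x); assert (H' := Rabs_pos y); lra.
Qed.

Lemma is_derive_small (f : R -> R) (l : R) (eps : R) :
  is_derive f 0 l -> 0 < eps -> exists d, 0 < d /\
    forall x, Rabs x < d -> Rabs (f x - f 0 - x * l) <= eps * Rabs x.
Proof.
intros [_ H] He.
assert (Hz : @is_filter_lim R_NormedModule (locally 0) 0) by (intros P HP; exact HP).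
destruct (H 0 Hz (mkposreal eps He)) as [d Hd].
exists d; split; [apply cond_pos|].
intros x Hx.
assert (B : ball 0 d x).
{ change (Rabs (x - 0) < d). now rewrite Rminus_0_r. }
specialize (Hd x B).
change (Rabs (f x - f 0 - (x - 0) * l) <= eps * Rabs (x - 0)) in Hd.
now rewrite Rminus_0_r in Hd.
Qed.

(** The addition law carries the derivative at 0 to every other point, so the real first-order
    expansions of [exp], [cos] and [sin] at 0 suffice. The remainder splits into four terms, and the
    fractions 6, 18, 6 and 24 make each at most [eps / 6 * |z|]; the minima with 1 give the crude
    bounds [|e^x - 1| <= 2 |z|] and [|sin y| <= 2 |z|]. *)
Lemma has_cderiv_cexp_0 : has_cderiv cexp 0 1.
Proof.
apply has_cderiv_iff; intros eps He.
destruct (is_derive_small exp 1 (Rmin 1 (eps / 6))) as [d1 [D1 H1]].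
{ assert (E := is_derive_exp 0); rewrite exp_0 in E; exact E. }
{ apply Rmin_case; lra. }
destruct (is_derive_small cos 0 (Rmin 1 (eps / 18))) as [d2 [D2 H2]].
{ assert (E := is_derive_cos 0); rewrite sin_0, Ropp_0 in E; exact E. }
{ apply Rmin_case; lra. }
destruct (is_derive_small sin 1 (Rmin 1 (eps / 6))) as [d3 [D3 H3]].
{ assert (E := is_derive_sin 0); rewrite cos_0 in E; exact E. }
{ apply Rmin_case; lra. }
set (d4 := Rmin 1 (eps / 24)).
assert (D4 : 0 < d4) by (unfold d4; apply Rmin_case; lra).
exists (Rmin (Rmin d1 d2) (Rmin d3 d4)); split; [apply Rmin_pos; apply Rmin_pos; assumption|].
intros z Hz; rewrite cexp_0.
replace (z - 0)%C with z in * by ring.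
assert (B : Cmod z < d1 /\ Cmod z < d2 /\ Cmod z < d3 /\ Cmod z < d4).
{ repeat split; eapply Rlt_le_trans; try exact Hz.
  - eapply Rle_trans; [apply Rmin_l|apply Rmin_l].
  - eapply Rle_trans; [apply Rmin_l|apply Rmin_r].
  - eapply Rle_trans; [apply Rmin_r|apply Rmin_l].
  - eapply Rle_trans; [apply Rmin_r|apply Rmin_r]. }
destruct B as [B1 [B2 [B3 B4]]].
assert (B5 : d4 <= 1 /\ d4 <= eps / 24) by (split; [apply Rmin_l|apply Rmin_r]).
destruct (Rabs_fst_snd_le_Cmod z) as [X Y].
destruct z as [x y]; simpl in X, Y.
set (m := Cmod (x, y)) in *.
specialize (H1 x ltac:(lra)); specialize (H2 y ltac:(lra)); specialize (H3 y ltac:(lra)).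
rewrite exp_0 in H1; rewrite cos_0 in H2; rewrite sin_0 in H3.
assert (H1' := Rmin_l 1 (eps / 6)). assert (H1'' := Rmin_r 1 (eps / 6)).
assert (H2' := Rmin_l 1 (eps / 18)). assert (H2'' := Rmin_r 1 (eps / 18)).
set (e1 := Rmin 1 (eps / 6)) in *. set (e2 := Rmin 1 (eps / 18)) in *.
assert (0 <= Rabs x) by apply Rabs_pos. assert (0 <= Rabs y) by apply Rabs_pos.
assert (E1 : Rabs (exp x - 1) <= 2 * m).
{ replace (exp x - 1) with ((exp x - 1 - x * 1) + x) by ring.
  eapply Rle_trans; [apply Rabs_triang|]. nra. }
assert (E2 : Rabs (cos y - 1) <= eps / 18 * m).
{ replace (cos y - 1) with (cos y - 1 - y * 0) by ring. nra. }
assert (E3 : Rabs (sin y) <= 2 * m).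
{ replace (sin y) with ((sin y - 0 - y * 1) + y) by ring.
  eapply Rle_trans; [apply Rabs_triang|]. nra. }
eapply Rle_trans; [apply Cmod_le_Rabs_fst_snd|].
unfold cexp; simpl.
replace (exp x * cos y + - (1) + - (x * 1 - y * 0))
  with ((exp x - 1 - x * 1) + ((exp x - 1) + 1) * (cos y - 1)) by ring.
replace (exp x * sin y + - 0 + - (x * 0 + y * 1))
  with ((sin y - 0 - y * 1) + (exp x - 1) * sin y) by ring.
eapply Rle_trans; [apply Rplus_le_compat; apply Rabs_triang|].
rewrite !Rabs_mult.
assert (E4 : Rabs (exp x - 1 + 1) <= 3).
{ eapply Rle_trans; [apply Rabs_triang|]. rewrite Rabs_R1. lra. }
assert (0 <= Rabs (exp x - 1 + 1)) by apply Rabs_pos.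
assert (0 <= Rabs (exp x - 1)) by apply Rabs_pos.
assert (0 <= Rabs (cos y - 1)) by apply Rabs_pos.
assert (0 <= Rabs (sin y)) by apply Rabs_pos.
assert (Rabs (exp x - 1 + 1) * Rabs (cos y - 1) <= 3 * (eps / 18 * m)) by (apply Rmult_le_compat; lra).
assert (Rabs (exp x - 1) * Rabs (sin y) <= 2 * m * (2 * m)) by (apply Rmult_le_compat; lra).
assert (0 <= m) by apply Cmod_ge_0.
assert (e1 * Rabs x <= eps / 6 * m) by (apply Rmult_le_compat; try lra; unfold e1; apply Rmin_case; lra).
assert (e1 * Rabs y <= eps / 6 * m) by (apply Rmult_le_compat; try lra; unfold e1; apply Rmin_case; lra).
nra.
Qed.

Lemma has_cderiv_cexp (z : C) : has_cderiv cexp z (cexp z).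
Proof.
apply (has_cderiv_ext_loc (fun x => cexp z * cexp (x - z))%C) with (d := 1); [lra| |].
{ intros y _; rewrite <- cexp_plus; f_equal; ring. }
apply has_cderiv_eq with (cexp z * ((1 - 0) * 1))%C; [|ring].
apply has_cderiv_scal.
apply (has_cderiv_comp cexp).
- replace (z - z)%C with (RtoC 0) by ring; apply has_cderiv_cexp_0.
- apply has_cderiv_minus; [apply has_cderiv_id|apply has_cderiv_const].
Qed.

(** * Circulation of a closed form along a rectangle *)

Lemma nested_intervals (x l : nat -> R) :
  (forall n, 0 <= l n) ->
  (forall n, x n <= x (S n)) -> (forall n, x (S n) + l (S n) <= x n + l n) ->
  exists u, forall n, x n <= u <= x n + l n.
Proof.
intros Hl Hx Hy.
assert (Mx : forall n k, x n <= x (n + k)%nat).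
{ intros n; induction k; [rewrite Nat.add_0_r; lra|].
  rewrite Nat.add_succ_r; specialize (Hx (n + k)%nat); lra. }
assert (My : forall n k, x (n + k)%nat + l (n + k)%nat <= x n + l n).
{ intros n; induction k; [rewrite Nat.add_0_r; lra|].
  rewrite Nat.add_succ_r; specialize (Hy (n + k)%nat); lra. }
assert (B : forall m n, x m <= x n + l n).
{ intros m n; destruct (Nat.le_ge_cases m n) as [H|H].
  - replace n with (m + (n - m))%nat by lia.
    specialize (Mx m (n - m)%nat); specialize (Hl (m + (n - m))%nat); lra.
  - replace m with (n + (m - n))%nat by lia.
    specialize (My n (m - n)%nat); specialize (Hl (n + (m - n))%nat); lra. }
destruct (completeness (fun r => exists n, r = x n)) as [u [U1 U2]].
- exists (x 0%nat + l 0%nat); intros r [n ->]; apply B.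
- exists (x 0%nat), 0%nat; reflexivity.
- exists u; intros n; split; [apply U1; now exists n|].
  apply U2; intros r [m ->]; apply B.
Qed.

(** Here [S n x y] is a property of the dyadic cell of level [n] with lower left corner [(x, y)]. If
    the whole rectangle fails, some quarter fails, and so on; the failing cells shrink to a point,
    where local validity is contradicted. The variable [S] hides the successor, which is therefore
    written [Datatypes.S]. *)
Lemma dyadic_square_induction (S : nat -> R -> R -> Prop) (a c L H : R) :
  0 <= L -> 0 <= H ->
  (forall n x y,
     let l := L / 2 ^ (n + 1) in let h := H / 2 ^ (n + 1) in
     S (n + 1)%nat x y -> S (n + 1)%nat (x + l) y ->
     S (n + 1)%nat x (y + h) -> S (n + 1)%nat (x + l) (y + h) -> S n x y) ->
  (forall u v, a <= u <= a + L -> c <= v <= c + H ->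
     exists d, 0 < d /\ forall n x y,
       let l := L / 2 ^ n in let h := H / 2 ^ n in
       x <= u <= x + l -> y <= v <= y + h -> l + h < d -> S n x y) ->
  S 0%nat a c.
Proof.
intros HL HH Hstep Hloc; apply NNPP; intros HS.
assert (Hp : forall n, 0 < 2 ^ n) by (intros; apply pow_lt; lra).
set (l := fun n => L / 2 ^ n); set (h := fun n => H / 2 ^ n).
assert (Hl : forall n, 0 <= l n) by (intros; apply Rdiv_le_0_compat; trivial).
assert (Hh : forall n, 0 <= h n) by (intros; apply Rdiv_le_0_compat; trivial).
assert (Hl2 : forall n, l n = 2 * l (n + 1)%nat).
{ intros; unfold l; rewrite pow_add; field; apply Rgt_not_eq, Hp. }
assert (Hh2 : forall n, h n = 2 * h (n + 1)%nat).
{ intros; unfold h; rewrite pow_add; field; apply Rgt_not_eq, Hp. }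
(* The failure of the cell is a premise inside the existential, so a corner exists for every cell
   and choice yields a total function [next]. *)
assert (E : forall s : nat * R * R, exists p : R * R,
  ~ S (fst (fst s)) (snd (fst s)) (snd s) ->
  ~ S (fst (fst s) + 1)%nat (fst p) (snd p) /\
  (fst p = snd (fst s) \/ fst p = snd (fst s) + l (fst (fst s) + 1)%nat) /\
  (snd p = snd s \/ snd p = snd s + h (fst (fst s) + 1)%nat)).
{ intros [[n x] y]; simpl.
  destruct (classic (S (n + 1)%nat x y)) as [S1|S1]; [|exists (x, y); tauto].
  destruct (classic (S (n + 1)%nat (x + l (n + 1)%nat) y)) as [S2|S2];
    [|exists (x + l (n + 1)%nat, y); simpl; tauto].
  destruct (classic (S (n + 1)%nat x (y + h (n + 1)%nat))) as [S3|S3];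
    [|exists (x, y + h (n + 1)%nat); simpl; tauto].
  exists (x + l (n + 1)%nat, y + h (n + 1)%nat); simpl; intros S0; split; [|tauto].
  intros S4; apply S0, Hstep; assumption. }
set (next := fun s => proj1_sig (constructive_indefinite_description _ (E s))).
assert (Hnext : forall s, ~ S (fst (fst s)) (snd (fst s)) (snd s) ->
  ~ S (fst (fst s) + 1)%nat (fst (next s)) (snd (next s)) /\
  (fst (next s) = snd (fst s) \/ fst (next s) = snd (fst s) + l (fst (fst s) + 1)%nat) /\
  (snd (next s) = snd s \/ snd (next s) = snd s + h (fst (fst s) + 1)%nat)).
{ intros s; exact (proj2_sig (constructive_indefinite_description _ (E s))). }
set (p := fix p n := match n with
  | O => (a, c) | Datatypes.S k => next (k, fst (p k), snd (p k)) end).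
assert (Hbad : forall n, ~ S n (fst (p n)) (snd (p n))).
{ induction n; [exact HS|].
  replace (Datatypes.S n) with (n + 1)%nat at 1 by lia.
  exact (proj1 (Hnext (n, fst (p n), snd (p n)) IHn)). }
assert (Hn : forall n, Datatypes.S n = (n + 1)%nat) by (intros; lia).
assert (Hpx : forall n, fst (p (Datatypes.S n)) = fst (p n) \/
   fst (p (Datatypes.S n)) = fst (p n) + l (n + 1)%nat)
  by (intros n; exact (proj1 (proj2 (Hnext (n, fst (p n), snd (p n)) (Hbad n))))).
assert (Hpy : forall n, snd (p (Datatypes.S n)) = snd (p n) \/
   snd (p (Datatypes.S n)) = snd (p n) + h (n + 1)%nat)
  by (intros n; exact (proj2 (proj2 (Hnext (n, fst (p n), snd (p n)) (Hbad n))))).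
destruct (nested_intervals (fun n => fst (p n)) l Hl) as [u Hu].
{ intros n; specialize (Hl (n + 1)%nat); destruct (Hpx n) as [-> | ->]; lra. }
{ intros n; specialize (Hl (n + 1)%nat); rewrite (Hl2 n), <- Hn in *.
  destruct (Hpx n) as [-> | ->]; rewrite <- ?Hn; lra. }
destruct (nested_intervals (fun n => snd (p n)) h Hh) as [v Hv].
{ intros n; specialize (Hh (n + 1)%nat); destruct (Hpy n) as [-> | ->]; lra. }
{ intros n; specialize (Hh (n + 1)%nat); rewrite (Hh2 n), <- Hn in *.
  destruct (Hpy n) as [-> | ->]; rewrite <- ?Hn; lra. }
destruct (Hloc u v) as [d [Hd Hlast]].
{ specialize (Hu 0%nat); unfold l in Hu; simpl in Hu; lra. }
{ specialize (Hv 0%nat); unfold h in Hv; simpl in Hv; lra. }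
assert (HN : exists n, l n + h n < d).
{ assert (Hlim : is_lim_seq (fun n => (L + H) * (/ 2) ^ n) ((L + H) * 0)).
  { apply (is_lim_seq_scal_l _ (L + H) 0), is_lim_seq_geom.
    rewrite Rabs_pos_eq; lra. }
  rewrite Rmult_0_r in Hlim.
  apply is_lim_seq_spec in Hlim.
  destruct (Hlim (mkposreal d Hd)) as [n Hn'].
  exists n; specialize (Hn' n (Nat.le_refl n)); simpl in Hn'.
  apply Rabs_lt_between in Hn'.
  replace (l n + h n) with ((L + H) * (/ 2) ^ n); [lra|].
  unfold l, h; rewrite pow_inv; field; apply Rgt_not_eq, Hp. }
destruct HN as [n HN].
exact (Hbad n (Hlast n _ _ (Hu n) (Hv n) HN)).
Qed.

Definition circulation (P Q : R -> R -> R) (x1 x2 y1 y2 : R) : R :=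
  RInt (fun t => P t y1) x1 x2 + RInt (Q x2) y1 y2
  - RInt (fun t => P t y2) x1 x2 - RInt (Q x1) y1 y2.

Lemma differentiable_pt_lim_partial (f : R -> R -> R) (x y lx ly : R) :
  differentiable_pt_lim f x y lx ly ->
  is_derive (fun t => f t y) x lx /\ is_derive (f x) y ly.
Proof.
intros Hf; split; apply is_derive_Reals.
- replace lx with (lx * 1 + ly * 0) by ring.
  apply (derivable_pt_lim_comp_2d f (fun t => t) (fun _ => y));
    [exact Hf|apply derivable_pt_lim_id|apply derivable_pt_lim_const].
- replace ly with (lx * 0 + ly * 1) by ring.
  apply (derivable_pt_lim_comp_2d f (fun _ => x) (fun t => t));
    [exact Hf|apply derivable_pt_lim_const|apply derivable_pt_lim_id].
Qed.

(** Subtracting the first-order expansions of [f] at two points near [(u, v)] cancels [f u v].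
    Differentiability at the single point [(u, v)] thus compares values on opposite sides of a small
    rectangle containing it. *)
Lemma differentiable_pt_lim_oscillation (f : R -> R -> R) (u v lx ly eps : R) :
  differentiable_pt_lim f u v lx ly -> 0 < eps ->
  exists d, 0 < d /\ forall s t s' t' r : R,
    Rabs (s - u) <= r -> Rabs (t - v) <= r ->
    Rabs (s' - u) <= r -> Rabs (t' - v) <= r -> r < d ->
    Rabs (f s t - f s' t' - (lx * (s - s') + ly * (t - t'))) <= eps * r.
Proof.
intros Hf He.
assert (He2 : 0 < eps / 2) by lra.
destruct (Hf (mkposreal _ He2)) as [d Hd]; simpl in Hd.
exists d; split; [apply cond_pos|].
intros s t s' t' r H1 H2 H3 H4 Hr.
assert (B1 := Hd s t ltac:(lra) ltac:(lra)).
assert (B2 := Hd s' t' ltac:(lra) ltac:(lra)).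
assert (M1 : Rmax (Rabs (s - u)) (Rabs (t - v)) <= r) by now apply Rmax_lub.
assert (M2 : Rmax (Rabs (s' - u)) (Rabs (t' - v)) <= r) by now apply Rmax_lub.
replace (f s t - f s' t' - (lx * (s - s') + ly * (t - t')))
  with ((f s t - f u v - (lx * (s - u) + ly * (t - v)))
        - (f s' t' - f u v - (lx * (s' - u) + ly * (t' - v)))) by ring.
eapply Rle_trans; [apply Rabs_triang|]; rewrite Rabs_Ropp.
nra.
Qed.

Lemma RInt_minus_close (f g : R -> R) (a b k M : R) :
  a <= b -> ex_RInt f a b -> ex_RInt g a b ->
  (forall t, a <= t <= b -> Rabs (f t - g t - k) <= M) ->
  Rabs (RInt f a b - RInt g a b - (b - a) * k) <= (b - a) * M.
Proof.
intros Hab Hf Hg H.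
assert (E : RInt (fun t => minus (minus (f t) (g t)) k) a b
            = RInt f a b - RInt g a b - (b - a) * k).
{ transitivity (minus (RInt (fun t => minus (f t) (g t)) a b) (RInt (fun _ => k) a b)).
  - apply (RInt_minus (fun t => minus (f t) (g t)) (fun _ => k));
      [now apply (ex_RInt_minus f g)|apply ex_RInt_const].
  - rewrite RInt_const.
    change (RInt (fun t => minus (f t) (g t)) a b - (b - a) * k
            = RInt f a b - RInt g a b - (b - a) * k).
    f_equal; now apply (RInt_minus f g). }
rewrite <- E; apply abs_RInt_le_const; trivial.
apply (ex_RInt_minus (fun t => minus (f t) (g t)) (fun _ => k)); [|apply ex_RInt_const].
now apply (ex_RInt_minus f g).
Qed.

(* Goursat's argument: subdividing the rectangle, a circulation exceeding
   [eps] times the squared perimeter would survive down to a point, where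
   differentiability and the symmetry [P_y = Q_x] exclude it. *)
Theorem goursat_rectangle (P Q : R -> R -> R) (x1 x2 y1 y2 : R) :
  x1 <= x2 -> y1 <= y2 ->
  (forall x y, x1 <= x <= x2 -> y1 <= y <= y2 -> exists k l m,
     differentiable_pt_lim P x y k l /\ differentiable_pt_lim Q x y l m) ->
  circulation P Q x1 x2 y1 y2 = 0.
Proof.
intros Hx Hy HD.
assert (IP : forall a b y, x1 <= a <= b -> b <= x2 -> y1 <= y <= y2 ->
  ex_RInt (fun t => P t y) a b).
{ intros a b y Ha Hb Hy'; apply (ex_RInt_continuous (fun t => P t y)); intros z Hz.
  rewrite Rmin_left, Rmax_right in Hz by lra.
  destruct (HD z y ltac:(lra) Hy') as (k & l & m & D & _).
  apply (ex_derive_continuous (fun t => P t y)); exists k.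
  now apply (differentiable_pt_lim_partial P z y k l). }
assert (IQ : forall a b x, y1 <= a <= b -> b <= y2 -> x1 <= x <= x2 ->
  ex_RInt (Q x) a b).
{ intros a b x Ha Hb Hx'; apply (ex_RInt_continuous (Q x)); intros z Hz.
  rewrite Rmin_left, Rmax_right in Hz by lra.
  destruct (HD x z Hx' ltac:(lra)) as (k & l & m & _ & D).
  apply (ex_derive_continuous (Q x)); exists m.
  now apply (differentiable_pt_lim_partial Q x z l m). }
assert (Hp : forall n, 0 < 2 ^ n) by (intros; apply pow_lt; lra).
set (L := x2 - x1); set (H := y2 - y1).
assert (HLn : forall n, 0 <= L / 2 ^ n) by (intros; apply Rdiv_le_0_compat; [unfold L; lra|trivial]).
assert (HHn : forall n, 0 <= H / 2 ^ n) by (intros; apply Rdiv_le_0_compat; [unfold H; lra|trivial]).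
assert (Hsmall : forall eps, 0 < eps ->
  Rabs (circulation P Q x1 x2 y1 y2) <= eps * (L + H) ^ 2).
2: { apply Rabs_eq_0, Rle_antisym; [|apply Rabs_pos].
  apply le_epsilon; intros e He; rewrite Rplus_0_l.
  assert (0 <= (L + H) ^ 2) by apply pow2_ge_0.
  assert (Hk : 0 < (L + H) ^ 2 + 1) by lra.
  assert (0 < / ((L + H) ^ 2 + 1)) by now apply Rinv_0_lt_compat.
  specialize (Hsmall (e * / ((L + H) ^ 2 + 1))).
  eapply Rle_trans; [apply Hsmall; nra|].
  apply Rmult_le_reg_r with ((L + H) ^ 2 + 1); trivial.
  replace (e * / ((L + H) ^ 2 + 1) * (L + H) ^ 2 * ((L + H) ^ 2 + 1))
    with (e * (L + H) ^ 2) by (field; lra).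
  nra. }
intros eps He.
assert (G := dyadic_square_induction (fun n x y =>
  let l := L / 2 ^ n in let h := H / 2 ^ n in
  x1 <= x -> x + l <= x2 -> y1 <= y -> y + h <= y2 ->
  Rabs (circulation P Q x (x + l) y (y + h)) <= eps * (l + h) ^ 2) x1 y1 L H).
cbv zeta in G.
replace x2 with (x1 + L / 2 ^ 0) at 1 by (unfold L; simpl; field).
replace y2 with (y1 + H / 2 ^ 0) at 1 by (unfold H; simpl; field).
replace ((L + H) ^ 2) with ((L / 2 ^ 0 + H / 2 ^ 0) ^ 2) by (simpl; field).
apply G; clear G; try (unfold L, H; simpl; lra).
- intros n x y S1 S2 S3 S4 B1 B2 B3 B4.
  assert (El : L / 2 ^ n = 2 * (L / 2 ^ (n + 1)))
    by (rewrite pow_add; field; apply Rgt_not_eq, Hp).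
  assert (Eh : H / 2 ^ n = 2 * (H / 2 ^ (n + 1)))
    by (rewrite pow_add; field; apply Rgt_not_eq, Hp).
  rewrite El in *; rewrite Eh in *.
  assert (Pl := HLn (n + 1)%nat); assert (Ph := HHn (n + 1)%nat).
  set (l := L / 2 ^ (n + 1)) in *; set (h := H / 2 ^ (n + 1)) in *.
  specialize (S1 ltac:(lra) ltac:(lra) ltac:(lra) ltac:(lra)).
  specialize (S2 ltac:(lra) ltac:(lra) ltac:(lra) ltac:(lra)).
  specialize (S3 ltac:(lra) ltac:(lra) ltac:(lra) ltac:(lra)).
  specialize (S4 ltac:(lra) ltac:(lra) ltac:(lra) ltac:(lra)).
  replace (x + l + l) with (x + 2 * l) in * by ring.
  replace (y + h + h) with (y + 2 * h) in * by ring.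
  assert (CP : forall t, y1 <= t <= y2 -> RInt (fun s => P s t) x (x + 2 * l)
     = RInt (fun s => P s t) x (x + l) + RInt (fun s => P s t) (x + l) (x + 2 * l)).
  { intros t Ht; symmetry; apply (RInt_Chasles (fun s => P s t)); apply IP; lra. }
  assert (CQ : forall s, x1 <= s <= x2 -> RInt (Q s) y (y + 2 * h)
     = RInt (Q s) y (y + h) + RInt (Q s) (y + h) (y + 2 * h)).
  { intros t Ht; symmetry; apply (RInt_Chasles (Q t)); apply IQ; lra. }
  replace (circulation P Q x (x + 2 * l) y (y + 2 * h)) with
    ((circulation P Q x (x + l) y (y + h)
      + circulation P Q (x + l) (x + 2 * l) y (y + h))
     + (circulation P Q x (x + l) (y + h) (y + 2 * h)
      + circulation P Q (x + l) (x + 2 * l) (y + h) (y + 2 * h)))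
    by (unfold circulation; rewrite !CP, !CQ by lra; ring).
  eapply Rle_trans; [apply Rabs_triang|].
  eapply Rle_trans; [apply Rplus_le_compat; apply Rabs_triang|].
  replace ((2 * l + 2 * h) ^ 2) with (4 * (l + h) ^ 2) by ring.
  replace (x + 2 * l - (x + l)) with l in * by ring.
  lra.
- intros u v Hu Hv.
  destruct (HD u v) as (k & l & m & D1 & D2); [unfold L, H in *; lra..|].
  destruct (differentiable_pt_lim_oscillation P u v k l eps D1 He) as [d1 [Hd1 O1]].
  destruct (differentiable_pt_lim_oscillation Q u v l m eps D2 He) as [d2 [Hd2 O2]].
  exists (Rmin d1 d2); split; [now apply Rmin_case|].
  intros n x y Hxu Hyv Hs B1 B2 B3 B4.
  assert (Hs1 : L / 2 ^ n + H / 2 ^ n < d1) by (eapply Rlt_le_trans; [exact Hs|apply Rmin_l]).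
  assert (Hs2 : L / 2 ^ n + H / 2 ^ n < d2) by (eapply Rlt_le_trans; [exact Hs|apply Rmin_r]).
  assert (Pl := HLn n); assert (Ph := HHn n).
  set (p := L / 2 ^ n) in *; set (q := H / 2 ^ n) in *.
  (* At first order the horizontal sides contribute [p * (- l * q)] and the vertical ones
     [q * (l * p)]. They cancel because the same [l] is both [P_y] and [Q_x]. *)
  assert (A1 := RInt_minus_close (fun t => P t y) (fun t => P t (y + q)) x (x + p)
    (- l * q) (eps * (p + q)) ltac:(lra)
    ltac:(apply IP; lra) ltac:(apply IP; lra)).
  assert (A2 := RInt_minus_close (Q (x + p)) (Q x) y (y + q)
    (l * p) (eps * (p + q)) ltac:(lra)
    ltac:(apply IQ; lra) ltac:(apply IQ; lra)).
  lapply A1; clear A1; [intros A1|].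
  2: { intros t Ht.
    replace (P t y - P t (y + q) - - l * q)
      with (P t y - P t (y + q) - (k * (t - t) + l * (y - (y + q)))) by ring.
    apply O1; try lra; apply Rabs_le; lra. }
  lapply A2; clear A2; [intros A2|].
  2: { intros t Ht.
    replace (Q (x + p) t - Q x t - l * p)
      with (Q (x + p) t - Q x t - (l * (x + p - x) + m * (t - t))) by ring.
    apply O2; try lra; apply Rabs_le; lra. }
  replace (circulation P Q x (x + p) y (y + q)) with
    ((RInt (fun t => P t y) x (x + p) - RInt (fun t => P t (y + q)) x (x + p)
       - (x + p - x) * (- l * q))
     + (RInt (Q (x + p)) y (y + q) - RInt (Q x) y (y + q) - (y + q - y) * (l * p)))
    by (unfold circulation; ring).
  eapply Rle_trans; [apply Rabs_triang|].
  replace (eps * (p + q) ^ 2)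
    with ((x + p - x) * (eps * (p + q)) + (y + q - y) * (eps * (p + q))) by ring.
  lra.
Qed.

(** * Limits at the origin and circle averages *)

(** The origin is excluded because the functions considered are quotients by [z] or [z^2], whose
    value there carries no meaning. *)
Definition tends0 (f : C -> C) (L : C) : Prop :=
  forall eps : R, 0 < eps -> exists d : R, 0 < d /\ forall z : C,
    z <> RtoC 0 -> Cmod z < d -> Cmod (f z - L) <= eps.

Lemma tends0_ext (f g : C -> C) (L : C) :
  (exists d, 0 < d /\ forall z, z <> RtoC 0 -> Cmod z < d -> f z = g z) ->
  tends0 f L -> tends0 g L.
Proof.
intros [d [Hd E]] H eps He; destruct (H eps He) as [d' [Hd' H']].
exists (Rmin d d'); split; [now apply Rmin_pos|].
intros z Hz Hm; rewrite <- E; trivial.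
- apply H'; trivial; eapply Rlt_le_trans; [exact Hm|apply Rmin_r].
- eapply Rlt_le_trans; [exact Hm|apply Rmin_l].
Qed.

Lemma tends0_eq (f : C -> C) (L L' : C) : tends0 f L -> L = L' -> tends0 f L'.
Proof. now intros H <-. Qed.

Lemma tends0_const (c : C) : tends0 (fun _ => c) c.
Proof.
intros eps He; exists 1; split; [lra|]; intros z _ _.
replace (c - c)%C with (RtoC 0) by ring; rewrite Cmod_0; lra.
Qed.

Lemma tends0_id : tends0 (fun z => z) 0.
Proof.
intros eps He; exists eps; split; [trivial|]; intros z _ Hz.
replace (z - 0)%C with z by ring; lra.
Qed.

Lemma tends0_plus (f g : C -> C) (L M : C) :
  tends0 f L -> tends0 g M -> tends0 (fun z => f z + g z)%C (L + M)%C.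
Proof.
intros Hf Hg eps He.
destruct (Hf (eps / 2) ltac:(lra)) as [d1 [D1 H1]].
destruct (Hg (eps / 2) ltac:(lra)) as [d2 [D2 H2]].
exists (Rmin d1 d2); split; [now apply Rmin_pos|]; intros z Hz Hm.
specialize (H1 z Hz ltac:(eapply Rlt_le_trans; [exact Hm|apply Rmin_l])).
specialize (H2 z Hz ltac:(eapply Rlt_le_trans; [exact Hm|apply Rmin_r])).
replace (f z + g z - (L + M))%C with ((f z - L) + (g z - M))%C by ring.
eapply Rle_trans; [apply Cmod_triangle|]; lra.
Qed.

Lemma tends0_mult (f g : C -> C) (L M : C) :
  tends0 f L -> tends0 g M -> tends0 (fun z => f z * g z)%C (L * M)%C.
Proof.
intros Hf Hg eps He.
set (K := Cmod L + Cmod M + 1).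
assert (PL := Cmod_ge_0 L); assert (PM := Cmod_ge_0 M).
assert (He' : 0 < Rmin 1 (eps / K)) by
  (apply Rmin_pos; [lra|apply Rdiv_lt_0_compat; unfold K; lra]).
destruct (Hf _ He') as [d1 [D1 H1]].
destruct (Hg _ He') as [d2 [D2 H2]].
exists (Rmin d1 d2); split; [now apply Rmin_pos|]; intros z Hz Hm.
specialize (H1 z Hz ltac:(eapply Rlt_le_trans; [exact Hm|apply Rmin_l])).
specialize (H2 z Hz ltac:(eapply Rlt_le_trans; [exact Hm|apply Rmin_r])).
assert (E1 := Rmin_l 1 (eps / K)); assert (E2 := Rmin_r 1 (eps / K)).
set (e := Rmin 1 (eps / K)) in *.
replace (f z * g z - L * M)%C
  with ((f z - L) * (g z - M) + (L * (g z - M) + M * (f z - L)))%C by ring.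
eapply Rle_trans; [apply Cmod_triangle|].
eapply Rle_trans; [apply Rplus_le_compat_l, Cmod_triangle|].
rewrite !Cmod_mult.
assert (P1 := Cmod_ge_0 (f z - L)); assert (P2 := Cmod_ge_0 (g z - M)).
assert (e * K <= eps).
{ apply Rmult_le_compat_r with (r := K) in E2; [|unfold K; lra].
  replace (eps / K * K) with eps in E2 by (field; unfold K; lra); exact E2. }
assert (Cmod (f z - L) * Cmod (g z - M) <= e * 1) by (apply Rmult_le_compat; lra).
assert (Cmod L * Cmod (g z - M) <= Cmod L * e) by (apply Rmult_le_compat_l; lra).
assert (Cmod M * Cmod (f z - L) <= Cmod M * e) by (apply Rmult_le_compat_l; lra).
unfold K in *; lra.
Qed.

Lemma tends0_minus (f g : C -> C) (L M : C) :
  tends0 f L -> tends0 g M -> tends0 (fun z => f z - g z)%C (L - M)%C.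
Proof.
intros Hf Hg; apply tends0_ext with (fun z => f z + (- (1)) * g z)%C.
- exists 1; split; [lra|]; intros; ring.
- apply tends0_eq with (L + (- (1)) * M)%C; [|ring].
  apply tends0_plus, tends0_mult; trivial; apply tends0_const.
Qed.

Lemma has_cderiv_continuous (f : C -> C) (z l : C) (eps : R) :
  has_cderiv f z l -> 0 < eps -> exists d, 0 < d /\ forall y,
    Cmod (y - z) < d -> Cmod (f y - f z) <= eps.
Proof.
intros Hf He; destruct (proj1 (has_cderiv_iff f z l) Hf 1 Rlt_0_1) as [d [Hd H]].
assert (Pl := Cmod_ge_0 l).
exists (Rmin d (eps / (Cmod l + 1))); split.
{ apply Rmin_pos; trivial; apply Rdiv_lt_0_compat; lra. }
intros y Hy.
assert (Y1 : Cmod (y - z) < d) by (eapply Rlt_le_trans; [exact Hy|apply Rmin_l]).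
assert (Y2 : Cmod (y - z) < eps / (Cmod l + 1)) by (eapply Rlt_le_trans; [exact Hy|apply Rmin_r]).
specialize (H y Y1).
apply Rmult_lt_compat_r with (r := Cmod l + 1) in Y2; [|lra].
replace (eps / (Cmod l + 1) * (Cmod l + 1)) with eps in Y2 by (field; lra).
replace (f y - f z)%C with ((f y - f z - (y - z) * l) + (y - z) * l)%C by ring.
eapply Rle_trans; [apply Cmod_triangle|]; rewrite Cmod_mult; lra.
Qed.

Lemma tends0_comp (g f : C -> C) (L l : C) :
  has_cderiv g L l -> tends0 f L -> tends0 (fun z => g (f z)) (g L).
Proof.
intros Hg Hf eps He.
destruct (has_cderiv_continuous g L l eps Hg He) as [d [Hd H]].
destruct (Hf (d / 2) ltac:(lra)) as [d' [Hd' H']].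
exists d'; split; trivial; intros z Hz Hm; apply H.
specialize (H' z Hz Hm); lra.
Qed.

Lemma tends0_quotient (f : C -> C) (l : C) :
  has_cderiv f 0 l -> tends0 (fun z => (f z - f 0) / z)%C l.
Proof.
intros Hf eps He; destruct (proj1 (has_cderiv_iff f 0 l) Hf eps He) as [d [Hd H]].
exists d; split; trivial; intros z Hz Hm.
specialize (H z); replace (z - 0)%C with z in H by ring.
replace ((f z - f 0) / z - l)%C with ((f z - f 0 - z * l) / z)%C by (field; trivial).
rewrite Cmod_div by trivial.
assert (0 < Cmod z) by now apply Cmod_gt_0.
apply Rmult_le_reg_r with (Cmod z); trivial.
unfold Rdiv; rewrite Rmult_assoc, Rinv_l by lra; rewrite Rmult_1_r; auto.
Qed.

Lemma tends0_unique (f : C -> C) (L M : C) : tends0 f L -> tends0 f M -> L = M.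
Proof.
intros HL HM.
assert (H : Cmod (L - M) <= 0).
{ apply le_epsilon; intros e He; rewrite Rplus_0_l.
  destruct (HL (e / 2) ltac:(lra)) as [d1 [D1 H1]].
  destruct (HM (e / 2) ltac:(lra)) as [d2 [D2 H2]].
  set (m := Rmin d1 d2 / 2).
  assert (M0 : 0 < Rmin d1 d2) by now apply Rmin_pos.
  assert (M1 := Rmin_l d1 d2); assert (M2 := Rmin_r d1 d2).
  assert (Hm : Cmod (RtoC m) = m) by (rewrite Cmod_R, Rabs_pos_eq; unfold m; lra).
  assert (Hm0 : RtoC m <> RtoC 0) by (intros E; apply RtoC_inj in E; unfold m in E; lra).
  specialize (H1 (RtoC m) Hm0 ltac:(rewrite Hm; unfold m; lra)).
  specialize (H2 (RtoC m) Hm0 ltac:(rewrite Hm; unfold m; lra)).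
  replace (L - M)%C with ((f (RtoC m) - M) + - (f (RtoC m) - L))%C by ring.
  eapply Rle_trans; [apply Cmod_triangle|]; rewrite Cmod_opp; lra. }
assert (E : (L - M)%C = RtoC 0) by (apply Cmod_eq_0, Rle_antisym; [exact H|apply Cmod_ge_0]).
replace L with ((L - M) + M)%C by ring; rewrite E; ring.
Qed.

(** These are the Cauchy-Riemann equations in total-differential form: the two components of the
    complex remainder are bounded by its modulus. They supply the symmetry [P_y = Q_x] when [P] is
    the imaginary part and [Q] the real part. *)
Lemma has_cderiv_differentiable (H : C -> C) (x y : R) (l : C) :
  has_cderiv H (x, y) l ->
  differentiable_pt_lim (fun s t => fst (H (s, t))) x y (fst l) (- snd l) /\
  differentiable_pt_lim (fun s t => snd (H (s, t))) x y (snd l) (fst l).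
Proof.
intros HH.
assert (K : forall eps : posreal, locally_2d (fun s t =>
   Cmod (H (s, t) - H (x, y) - ((s, t) - (x, y)) * l)
     <= eps * Rmax (Rabs (s - x)) (Rabs (t - y))) x y).
{ intros eps.
  destruct (proj1 (has_cderiv_iff H (x, y) l) HH (eps / 2)) as [d [Hd B]].
  { assert (P := cond_pos eps); lra. }
  assert (Hd2 : 0 < d / 2) by lra.
  exists (mkposreal _ Hd2); simpl; intros s t Hs Ht.
  assert (E := Cmod_le_Rabs_fst_snd ((s, t) - (x, y))%C); simpl in E.
  change (s + - x) with (s - x) in E; change (t + - y) with (t - y) in E.
  specialize (B (s, t) ltac:(lra)).
  assert (M1 := Rmax_l (Rabs (s - x)) (Rabs (t - y))).
  assert (M2 := Rmax_r (Rabs (s - x)) (Rabs (t - y))).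
  assert (P := cond_pos eps).
  eapply Rle_trans; [exact B|].
  apply Rle_trans with (eps / 2 * (2 * Rmax (Rabs (s - x)) (Rabs (t - y)))); [|lra].
  apply Rmult_le_compat_l; lra. }
split; intros eps; destruct (K eps) as [d B]; exists d; intros s t Hs Ht;
  specialize (B s t Hs Ht); destruct (Rabs_fst_snd_le_Cmod
    (H (s, t) - H (x, y) - ((s, t) - (x, y)) * l)%C) as [B1 B2]; simpl in B1, B2.
- replace (fst (H (s, t)) - fst (H (x, y)) - (fst l * (s - x) + - snd l * (t - y)))
    with (fst (H (s, t)) + - fst (H (x, y)) +
          - ((s + - x) * fst l - (t + - y) * snd l)) by ring; lra.
- replace (snd (H (s, t)) - snd (H (x, y)) - (snd l * (s - x) + fst l * (t - y)))
    with (snd (H (s, t)) + - snd (H (x, y)) +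
          - ((s + - x) * snd l + (t + - y) * fst l)) by ring; lra.
Qed.

Lemma Cmod_polar (r t : R) : 0 <= r -> Cmod (r * cos t, r * sin t) = r.
Proof.
intros Hr; unfold Cmod; simpl fst; simpl snd.
replace ((r * cos t) ^ 2 + (r * sin t) ^ 2) with (r ^ 2).
- now apply sqrt_pow2.
- assert (T := sin2_cos2 t); unfold Rsqr in T; nra.
Qed.

(* In the logarithmic coordinate [s + i t] with [z = exp (s + i t)] the
   puncture is at [s = - infinity] and circles become vertical segments, so
   Goursat on rectangles of height [2 PI] makes circle averages constant. *)
Lemma punctured_mean_value (F : C -> C) (L : C) (r : R) :
  0 < r < 1 ->
  (forall z, in_disc z -> z <> RtoC 0 -> exists l, has_cderiv F z l) ->
  tends0 F L ->
  is_RInt (fun t => fst (F (r * cos t, r * sin t))) 0 (2 * PI) (2 * PI * fst L).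
Proof.
intros Hr HF HL.
assert (HPI := PI_RGT_0).
set (H := fun z => F (cexp z)).
assert (Hmod : forall s t, Cmod (cexp (s, t)) = exp s)
  by (intros s t; apply Cmod_polar; left; apply exp_pos).
assert (HD : forall s t, s <= ln r -> exists l, has_cderiv H (s, t) l).
{ intros s t Hs.
  destruct (HF (cexp (s, t))) as [l Hl].
  - unfold in_disc; rewrite Hmod; apply Rle_lt_trans with (exp (ln r)).
    + destruct Hs as [Hs | ->]; [left; now apply exp_increasing|lra].
    + rewrite exp_ln; lra.
  - apply cexp_neq_0.
  - exists (cexp (s, t) * l)%C; apply (has_cderiv_comp F cexp); trivial.
    apply has_cderiv_cexp. }
assert (HI : forall s a b, s <= ln r -> ex_RInt (fun t => fst (H (s, t))) a b).
{ intros s a b Hs; apply (ex_RInt_continuous (fun t => fst (H (s, t)))); intros t _.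
  destruct (HD s t Hs) as [l Hl].
  apply (ex_derive_continuous (fun t => fst (H (s, t)))); exists (- snd l).
  apply (differentiable_pt_lim_partial (fun s t => fst (H (s, t))) s t (fst l)).
  now apply has_cderiv_differentiable. }
set (J := RInt (fun t => fst (H (ln r, t))) 0 (2 * PI)).
assert (HJ : forall s, s <= ln r -> RInt (fun t => fst (H (s, t))) 0 (2 * PI) = J).
{ intros s Hs.
  (* The form is the imaginary part of [H dz]. Its integrals along the horizontal sides cancel by
     the period [2 PI] of [cexp] in [t], leaving the two vertical ones equal. *)
  assert (G := goursat_rectangle (fun s t => snd (H (s, t))) (fun s t => fst (H (s, t)))
     s (ln r) 0 (2 * PI) Hs ltac:(lra)).
  lapply G; clear G; [intros G|].
  - unfold circulation in G.
    rewrite (RInt_ext (fun t => snd (H (t, 2 * PI))) (fun t => snd (H (t, 0)))) in G.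
    + unfold J; lra.
    + intros t _; unfold H, cexp; simpl; now rewrite cos_2PI, sin_2PI, cos_0, sin_0.
  - intros x y Hx _; destruct (HD x y ltac:(lra)) as [l Hl].
    destruct (has_cderiv_differentiable H x y l Hl) as [D1 D2].
    now exists (snd l), (fst l), (- snd l). }
assert (EJ : J = 2 * PI * fst L).
{ assert (Z : Rabs (J - 2 * PI * fst L) <= 0).
  { apply le_epsilon; intros e He; rewrite Rplus_0_l.
    destruct (HL (e / (2 * PI))) as [d [Hd B]]; [apply Rdiv_lt_0_compat; lra|].
    (* The segment is moved so far left that its image is a circle of radius at most [d / 2], on
       which [F] is uniformly close to [L]. *)
    set (s := Rmin (ln r) (ln (d / 2))).
    assert (Hs : s <= ln r) by apply Rmin_l.
    assert (Hs2 : exp s < d).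
    { apply Rle_lt_trans with (exp (ln (d / 2))); [|rewrite exp_ln; lra].
      destruct (Rmin_r (ln r) (ln (d / 2))) as [Q|Q]; unfold s.
      - left; now apply exp_increasing.
      - rewrite Q; lra. }
    rewrite <- (HJ s Hs).
    assert (A := RInt_minus_close (fun t => fst (H (s, t))) (fun _ => 0) 0 (2 * PI)
       (fst L) (e / (2 * PI)) ltac:(lra) (HI _ _ _ Hs) (ex_RInt_const _ _ _)).
    rewrite RInt_const in A.
    change (scal (2 * PI - 0) 0) with ((2 * PI - 0) * 0) in A.
    lapply A; clear A; [intros A|].
    - replace ((2 * PI - 0) * (e / (2 * PI))) with e in A by (field; lra).
      eapply Rle_trans; [|exact A]; right; f_equal; ring.
    - intros t _.
      specialize (B (cexp (s, t)) (cexp_neq_0 _) ltac:(rewrite Hmod; exact Hs2)).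
      destruct (Rabs_fst_snd_le_Cmod (F (cexp (s, t)) - L)%C) as [B1 _].
      simpl in B1; unfold H; eapply Rle_trans; [|exact B].
      eapply Rle_trans; [|exact B1]; right; f_equal; ring. }
  assert (Z' := Rabs_pos (J - 2 * PI * fst L)).
  assert (Z'' := Rabs_eq_0 (J - 2 * PI * fst L) ltac:(lra)); lra. }
rewrite <- EJ.
apply (is_RInt_ext (fun t => fst (H (ln r, t)))).
- intros t _; unfold H, cexp; simpl; rewrite exp_ln; [reflexivity|lra].
- apply (RInt_correct (fun t => fst (H (ln r, t)))), HI; lra.
Qed.

(** * The second coefficient of a Schwarz function *)

Lemma is_RInt_trig_poly (m a b : R) :
  is_RInt (fun t => m + (a * cos t + b * sin t)) 0 (2 * PI) (2 * PI * m).
Proof.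
assert (D : forall t, is_derive (fun t => m * t + (a * sin t - b * cos t)) t
   (m + (a * cos t + b * sin t))).
{ intros t; auto_derive; [trivial|ring]. }
replace (2 * PI * m) with
  (minus (m * (2 * PI) + (a * sin (2 * PI) - b * cos (2 * PI)))
         (m * 0 + (a * sin 0 - b * cos 0))).
2: { rewrite sin_2PI, cos_2PI, sin_0, cos_0; unfold minus, plus, opp; simpl; ring. }
apply (is_RInt_derive (fun t => m * t + (a * sin t - b * cos t))); [intros; apply D|].
intros t _; apply (ex_derive_continuous (fun t => m + (a * cos t + b * sin t))).
auto_derive; trivial.
Qed.

Lemma Cmod_sqr (z : C) : Cmod z * Cmod z = fst z ^ 2 + snd z ^ 2.
Proof.
unfold Cmod; apply sqrt_sqrt.
assert (0 <= fst z ^ 2) by apply pow2_ge_0; assert (0 <= snd z ^ 2) by apply pow2_ge_0; lra.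
Qed.

Lemma exists_unimodular_rotation (z : C) :
  exists k : C, Cmod k = 1 /\ (k * z)%C = RtoC (Cmod z).
Proof.
destruct (classic (z = RtoC 0)) as [-> | Hz].
- exists (RtoC 1); rewrite Cmod_1, Cmod_0; split; [trivial|ring].
- assert (H : 0 < Cmod z) by now apply Cmod_gt_0.
  assert (H' : RtoC (Cmod z) <> RtoC 0) by (intros E; apply RtoC_inj in E; lra).
  exists (Cconj z / RtoC (Cmod z))%C; split.
  + rewrite Cmod_div, Cmod_conj, Cmod_R, Rabs_pos_eq by (trivial; lra).
    field; lra.
  + replace (Cconj z / RtoC (Cmod z) * z)%C with (z * Cconj z / RtoC (Cmod z))%C
      by (field; trivial).
    rewrite <- Cmod2_conj, RtoC_pow; field; trivial.
Qed.

(* Testing [w / z^2] against [(1 + y z)^2], whose modulus on [|z| = r] is the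
   trigonometric polynomial [1 + |y|^2 r^2 + 2 Re (y z)]. *)
Lemma schwarz_coeff_test (w : C -> C) (c1 c2 y k : C) :
  (forall z, in_disc z -> exists l, has_cderiv w z l) ->
  (forall z, in_disc z -> Cmod (w z) <= 1) ->
  tends0 (fun z => (w z - c1 * z) / (z * z))%C c2 ->
  Cmod k = 1 ->
  fst (k * (c2 + 2 * (y * c1)))%C <= 1 + Cmod y * Cmod y.
Proof.
intros Hw Hb Hc Hk.
(* Near 0, [w z * (1 + y z)^2 / z^2] behaves like [c1 / z + (c2 + 2 y c1)]. Removing the simple pole
   gives [F] a finite limit at the puncture. *)
set (F := fun z => (k * ((w z * ((1 + y * z) * (1 + y * z))) * / (z * z) - c1 * / z))%C).
set (X := fst (k * (c2 + 2 * (y * c1)))%C); set (Y := Cmod y * Cmod y).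
assert (HF : forall z, in_disc z -> z <> RtoC 0 -> exists l, has_cderiv F z l).
{ intros z Hz Hz0; destruct (Hw z Hz) as [lw Hlw]; eexists.
  assert (Hi : has_cderiv (fun z => / z)%C z (- / (z * z))%C) by now apply has_cderiv_inv.
  assert (Hy : has_cderiv (fun z => 1 + y * z)%C z (0 + y * 1)%C)
    by (apply has_cderiv_plus; [apply has_cderiv_const|apply has_cderiv_scal, has_cderiv_id]).
  apply has_cderiv_scal, has_cderiv_minus; [|apply has_cderiv_scal, Hi].
  apply has_cderiv_mult; [apply has_cderiv_mult; [exact Hlw|apply has_cderiv_mult; exact Hy]|].
  apply (has_cderiv_comp Cinv (fun z => z * z)%C).
  - apply has_cderiv_inv; now apply Cmult_neq_0.
  - apply has_cderiv_mult; apply has_cderiv_id. }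
assert (HL : tends0 F (k * (c2 + 2 * (y * c1)))%C).
{ apply tends0_ext with (fun z =>
    k * ((w z - c1 * z) / (z * z) * ((1 + y * z) * (1 + y * z))
         + (2 * (y * c1) + c1 * (y * y) * z)))%C.
  { exists 1; split; [lra|]; intros z Hz _; unfold F; field; trivial. }
  assert (Hy : tends0 (fun z => 1 + y * z)%C (1 + y * 0)%C)
    by (apply tends0_plus; [apply tends0_const|apply tends0_mult; [apply tends0_const|apply tends0_id]]).
  eapply tends0_eq.
  { apply tends0_mult; [apply tends0_const|].
    apply tends0_plus; [apply tends0_mult; [exact Hc|apply tends0_mult; exact Hy]|].
    apply tends0_plus; [apply tends0_const|apply tends0_mult; [apply tends0_const|apply tends0_id]]. }
  ring. }
assert (Hr : forall r, 0 < r < 1 -> X * (r * r) <= 1 + Y * (r * r)).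
{ intros r Hr.
  assert (I := punctured_mean_value F _ r Hr HF HL); fold X in I.
  (* On [|z| = r] the real part of [F] is at most [|1 + y z|^2 / r^2 - Re (q / z)], which equals
     [m + a cos t + b sin t]; only [m] survives integration. *)
  set (m := (1 + Y * (r * r)) / (r * r)).
  set (q := (k * c1)%C).
  set (a := 2 * fst y * / r - fst q / r); set (b := - (2 * snd y / r) - snd q / r).
  assert (T := is_RInt_trig_poly m a b).
  assert (B : 2 * PI * X <= 2 * PI * m).
  { rewrite <- (is_RInt_unique _ _ _ _ I), <- (is_RInt_unique _ _ _ _ T).
    assert (HPI := PI_RGT_0).
    apply RInt_le; [lra|now exists (2 * PI * X)|now exists (2 * PI * m)|].
    intros t _.
    set (z := (r * cos t, r * sin t)).
    assert (Mz : Cmod z = r) by (apply Cmod_polar; lra).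
    assert (Hz0 : z <> RtoC 0) by (apply Cmod_gt_0; lra).
    assert (SC : sin t * sin t + cos t * cos t = 1) by apply sin2_cos2.
    assert (E1 : fst (q * / z)%C = fst q / r * cos t + snd q / r * sin t).
    { unfold z, Cinv, Cmult; simpl.
      replace (r * cos t * (r * cos t * 1) + r * sin t * (r * sin t * 1)) with (r * r)
        by (replace (r * r) with (r * r * (sin t * sin t + cos t * cos t)) by (rewrite SC; ring); ring).
      field; lra. }
    assert (E2 : Cmod (1 + y * z) * Cmod (1 + y * z)
                 = 1 + Y * (r * r) + 2 * r * (fst y * cos t - snd y * sin t)).
    { unfold Y; rewrite !Cmod_sqr; unfold z; simpl.
      replace (1 + (fst y * (fst y * 1) + snd y * (snd y * 1)) * (r * r)) with
       (1 + (fst y * (fst y * 1) + snd y * (snd y * 1)) * (r * r)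
            * (sin t * sin t + cos t * cos t)) by (rewrite SC; ring).
      ring. }
    replace (F z) with ((k * (w z * ((1 + y * z) * (1 + y * z)) * / (z * z))) - q * / z)%C
      by (unfold F, q; ring).
    set (G := (k * (w z * ((1 + y * z) * (1 + y * z)) * / (z * z)))%C).
    change (fst G - fst (q * / z)%C <= m + (a * cos t + b * sin t)).
    rewrite E1.
    assert (HG : fst G <= (1 + Y * (r * r) + 2 * r * (fst y * cos t - snd y * sin t)) / (r * r)).
    { eapply Rle_trans; [apply Rle_abs|].
      eapply Rle_trans; [apply Rabs_fst_snd_le_Cmod|].
      rewrite <- E2; unfold G.
      rewrite !Cmod_mult, Cmod_inv, Cmod_mult, Hk, Mz, Rmult_1_l by now apply Cmult_neq_0.
      apply Rmult_le_compat_r; [left; apply Rinv_0_lt_compat; nra|].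
      assert (W := Hb z ltac:(unfold in_disc; lra)).
      assert (N := Rle_0_sqr (Cmod (1 + y * z))); unfold Rsqr in N.
      nra. }
    replace (m + (a * cos t + b * sin t)) with
      ((1 + Y * (r * r) + 2 * r * (fst y * cos t - snd y * sin t)) / (r * r)
       - (fst q / r * cos t + snd q / r * sin t)) by (unfold m, a, b; field; lra).
    lra. }
  assert (HPI := PI_RGT_0).
  assert (B' : X <= m) by (apply Rmult_le_reg_l with (2 * PI); lra).
  apply Rmult_le_compat_r with (r := r * r) in B'; [|nra].
  replace (m * (r * r)) with (1 + Y * (r * r)) in B' by (unfold m; field; lra); exact B'. }
apply Rnot_lt_le; intros Hlt.
assert (HY : 0 <= Y) by (unfold Y; apply Rmult_le_pos; apply Cmod_ge_0).
fold Y in Hlt.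
(* [r^2 = s] strictly between [1 / (X - Y)] and [1]. *)
set (s := (1 + / (X - Y)) / 2).
assert (Hi : 0 < / (X - Y) < 1).
{ split; [apply Rinv_0_lt_compat; lra|].
  rewrite <- Rinv_1; apply Rinv_lt_contravar; lra. }
assert (Hs : 0 < s < 1) by (unfold s; lra).
specialize (Hr (sqrt s)); rewrite sqrt_sqrt in Hr by lra.
assert (S1 : 0 < sqrt s < 1).
{ split; [apply sqrt_lt_R0; lra|]. rewrite <- sqrt_1; apply sqrt_lt_1_alt; lra. }
specialize (Hr S1).
assert ((X - Y) * s = (X - Y + 1) / 2) by (unfold s; field; lra).
nra.
Qed.

(** Let [k] rotate [c2] onto [|c2|]. The choice [y = Cconj k * Cconj c1] gives [k y c1 = |c1|^2] and
    [|y| = |c1|], so the test inequality becomes [|c2| + 2 |c1|^2 <= 1 + |c1|^2]. *)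
Lemma schwarz_second_coeff (w : C -> C) (c1 c2 : C) :
  (forall z, in_disc z -> exists l, has_cderiv w z l) ->
  (forall z, in_disc z -> Cmod (w z) <= 1) ->
  tends0 (fun z => (w z - c1 * z) / (z * z))%C c2 ->
  Cmod c2 <= 1 - Cmod c1 * Cmod c1.
Proof.
intros Hw Hb Hc.
destruct (exists_unimodular_rotation c2) as [k [Hk Hkc]].
assert (T := schwarz_coeff_test w c1 c2 (Cconj k * Cconj c1) k Hw Hb Hc Hk).
replace (k * (c2 + 2 * (Cconj k * Cconj c1 * c1)))%C
  with (k * c2 + 2 * ((k * Cconj k) * (c1 * Cconj c1)))%C in T by ring.
rewrite Hkc, <- !Cmod2_conj, Hk, Cmod_mult, !Cmod_conj, Hk in T.
simpl in T; lra.
Qed.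

(** * Complex series *)

Definition Cseries (a : nat -> C) (l : C) : Prop := @is_series C_AbsRing C_NormedModule a l.

Lemma fst_snd_sum_n (a : nat -> C) (n : nat) :
  fst (@sum_n C_NormedModule a n) = sum_n (fun k => fst (a k)) n /\
  snd (@sum_n C_NormedModule a n) = sum_n (fun k => snd (a k)) n.
Proof.
induction n as [|n [IH1 IH2]]; [rewrite !sum_O; now split|].
rewrite !sum_Sn, <- IH1, <- IH2; now split.
Qed.

Lemma Cseries_iff (a : nat -> C) (l : C) :
  Cseries a l <->
  is_series (fun n => fst (a n)) (fst l) /\ is_series (fun n => snd (a n)) (snd l).
Proof.
assert (EC : Cseries a l <-> forall eps : posreal, eventually (fun n =>
   @ball C_UniformSpace l eps (@sum_n C_NormedModule a n)))
  by exact (filterlim_locally (U := C_UniformSpace) (@sum_n C_NormedModule a) l).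
assert (ER : forall (f : nat -> R) (x : R), is_series f x <-> forall eps : posreal,
   eventually (fun n => ball x eps (sum_n f n)))
  by (intros f x; exact (filterlim_locally (U := R_UniformSpace) (sum_n f) x)).
rewrite EC, !ER; clear EC ER; split.
- intros H; split; intros eps; destruct (H eps) as [N HN]; exists N; intros n Hn;
    destruct (HN n Hn) as [H1 H2]; destruct (fst_snd_sum_n a n) as [E1 E2].
  + rewrite <- E1; exact H1.
  + rewrite <- E2; exact H2.
- intros [H1 H2] eps; destruct (H1 eps) as [N1 HN1]; destruct (H2 eps) as [N2 HN2].
  exists (max N1 N2); intros n Hn; destruct (fst_snd_sum_n a n) as [E1 E2]; split.
  + assert (B := HN1 n ltac:(lia)); rewrite <- E1 in B; exact B.
  + assert (B := HN2 n ltac:(lia)); rewrite <- E2 in B; exact B.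
Qed.

Lemma Cseries_ext (a b : nat -> C) (l : C) :
  (forall n, a n = b n) -> Cseries a l -> Cseries b l.
Proof. apply (is_series_ext (V := C_NormedModule)). Qed.

Lemma Cseries_unique (a : nat -> C) (l l' : C) : Cseries a l -> Cseries a l' -> l = l'.
Proof.
rewrite !Cseries_iff; intros [H1 H2] [H3 H4]; apply injective_projections.
- now rewrite <- (is_series_unique _ _ H1), <- (is_series_unique _ _ H3).
- now rewrite <- (is_series_unique _ _ H2), <- (is_series_unique _ _ H4).
Qed.

Lemma Cseries_plus (a b : nat -> C) (la lb : C) :
  Cseries a la -> Cseries b lb -> Cseries (fun n => a n + b n)%C (la + lb)%C.
Proof. apply (is_series_plus (V := C_NormedModule)). Qed.

Lemma Cseries_scal (c : C) (a : nat -> C) (l : C) :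
  Cseries a l -> Cseries (fun n => c * a n)%C (c * l)%C.
Proof. apply (is_series_scal_l (V := C_NormedModule)). Qed.

Lemma Cseries_shift (a : nat -> C) (l : C) :
  Cseries (fun n => a (S n)) l <-> Cseries a (a 0%nat + l)%C.
Proof.
split; intros H.
- replace l with ((a 0%nat + l) + - a 0%nat)%C in H by ring.
  exact (is_series_decr_1 (V := C_NormedModule) _ _ H).
- replace (a 0%nat + l)%C with (l + a 0%nat)%C in H by ring.
  exact (is_series_incr_1 (V := C_NormedModule) _ _ H).
Qed.

(** Rotating the sum onto the nonnegative real axis reduces the bound to a comparison of real
    series. *)
Lemma Cseries_norm_le (a : nat -> C) (b : nat -> R) (l : C) (lb : R) :
  Cseries a l -> (forall n, Cmod (a n) <= b n) -> is_series b lb -> Cmod l <= lb.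
Proof.
intros Ha Hab Hb.
destruct (exists_unimodular_rotation l) as [k [Hk Hkl]].
apply (Cseries_scal k) in Ha; rewrite Hkl in Ha.
apply Cseries_iff in Ha; destruct Ha as [Ha _]; simpl in Ha.
apply (is_lim_seq_le (sum_n (fun n => fst (k * a n)%C)) (sum_n b)
  (Finite (Cmod l)) (Finite lb)); [|exact Ha|exact Hb].
intros n; apply sum_n_m_le; intros m.
eapply Rle_trans; [apply Rle_abs|].
eapply Rle_trans; [apply Rabs_fst_snd_le_Cmod|].
rewrite Cmod_mult, Hk, Rmult_1_l; apply Hab.
Qed.

Lemma ex_Cseries (a : nat -> C) (b : nat -> R) :
  (forall n, Cmod (a n) <= b n) -> ex_series b ->
  Cseries a (Series (fun n => fst (a n)), Series (fun n => snd (a n))).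
Proof.
intros Hab Hb; apply Cseries_iff; split; apply Series_correct;
  apply (@ex_series_le R_AbsRing R_CompleteNormedModule _ b); trivial; intros n;
  (eapply Rle_trans; [apply Rabs_fst_snd_le_Cmod|apply Hab]).
Qed.

(** The Cauchy product of absolutely convergent series, assembled from the four real products of
    real and imaginary parts. *)
Lemma Cseries_mult (a b : nat -> C) (la lb : C) :
  Cseries a la -> Cseries b lb ->
  ex_series (fun n => Cmod (a n)) -> ex_series (fun n => Cmod (b n)) ->
  Cseries (fun n => @sum_n C_NormedModule (fun k => a k * b (n - k)%nat)%C n) (la * lb)%C.
Proof.
intros Ha Hb Aa Ab; rewrite Cseries_iff in *.
destruct Ha as [Ha1 Ha2]; destruct Hb as [Hb1 Hb2].
assert (A : forall c : nat -> C, ex_series (fun n => Cmod (c n)) ->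
   ex_series (fun n => Rabs (fst (c n))) /\ ex_series (fun n => Rabs (snd (c n)))).
{ intros c Hc; split; (apply (@ex_series_le R_AbsRing R_CompleteNormedModule _ (fun n => Cmod (c n))); [|exact Hc]); intros n;
    (eapply Rle_trans; [right; apply Rabs_Rabsolu|apply Rabs_fst_snd_le_Cmod]). }
destruct (A a Aa) as [Aa1 Aa2]; destruct (A b Ab) as [Ab1 Ab2].
split.
- eapply is_series_ext; [|exact (is_series_minus _ _ _ _
    (is_series_mult _ _ _ _ Ha1 Hb1 Aa1 Ab1) (is_series_mult _ _ _ _ Ha2 Hb2 Aa2 Ab2))].
  intros n; symmetry; etransitivity; [exact (proj1 (fst_snd_sum_n _ n))|]; simpl.
  rewrite <- !sum_n_Reals.
  change (sum_n (fun k => fst (a k) * fst (b (n - k)%nat) - snd (a k) * snd (b (n - k)%nat)) n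
    = sum_n (fun k => fst (a k) * fst (b (n - k)%nat)) n
      - sum_n (fun k => snd (a k) * snd (b (n - k)%nat)) n).
  rewrite !sum_n_Reals; apply minus_sum.
- eapply is_series_ext; [|exact (is_series_plus _ _ _ _
    (is_series_mult _ _ _ _ Ha1 Hb2 Aa1 Ab2) (is_series_mult _ _ _ _ Ha2 Hb1 Aa2 Ab1))].
  intros n; symmetry; etransitivity; [exact (proj2 (fst_snd_sum_n _ n))|]; simpl.
  rewrite <- !sum_n_Reals.
  change (sum_n (fun k => fst (a k) * snd (b (n - k)%nat) + snd (a k) * fst (b (n - k)%nat)) n
    = sum_n (fun k => fst (a k) * snd (b (n - k)%nat)) n
      + sum_n (fun k => snd (a k) * fst (b (n - k)%nat)) n).
  rewrite !sum_n_Reals; apply plus_sum.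
Qed.

(** * Power series on the unit disc *)

Lemma Cmod_cpow (z : C) (n : nat) : Cmod (cpow z n) = Cmod z ^ n.
Proof. induction n; simpl; [apply Cmod_1|now rewrite Cmod_mult, IHn]. Qed.

Lemma cpow_add (z : C) (m n : nat) : cpow z (m + n) = (cpow z m * cpow z n)%C.
Proof. induction m; simpl; [ring|rewrite IHm; ring]. Qed.

(* Radius of convergence at least [1]. *)
Definition disc_coeffs (a : nat -> C) : Prop :=
  forall r, 0 < r < 1 -> exists M, forall n, Cmod (a n) * r ^ n <= M.

(** A total function: [Series] returns a default value on divergent series, so this is the sum only
    where convergence is known, as for [disc_coeffs a] and [|z| < 1]. *)
Definition cpser (a : nat -> C) (z : C) : C :=
  (Series (fun n => fst (a n * cpow z n)%C), Series (fun n => snd (a n * cpow z n)%C)).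

(** With [s = sqrt q], the sum [1 + s + ... + s^(n-1) = (1 - s^n) / (1 - s)] has [n] terms, each at
    least [s^n]. This bounds [n s^n], and squaring gives the claim. *)
Lemma nat_sqr_pow_bounded (q : R) :
  0 < q < 1 -> exists K, forall n, INR n ^ 2 * q ^ n <= K.
Proof.
intros Hq.
assert (Hs : 0 < sqrt q < 1).
{ split; [apply sqrt_lt_R0; lra|]; rewrite <- sqrt_1; apply sqrt_lt_1_alt; lra. }
set (s := sqrt q) in *.
assert (B : forall n, INR n * s ^ n * (1 - s) <= 1 - s ^ n).
{ induction n; [simpl; lra|].
  assert (P : 0 <= s ^ n) by (apply pow_le; lra).
  rewrite S_INR; simpl.
  assert (N := pos_INR n).
  assert (s * (INR n * s ^ n * (1 - s)) <= s * (1 - s ^ n)) by (apply Rmult_le_compat_l; lra).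
  assert (0 <= INR n * s ^ n * (1 - s)) by (apply Rmult_le_pos; [now apply Rmult_le_pos|lra]).
  assert (0 <= (1 - s) * (1 - s * s ^ n)) by (apply Rmult_le_pos; [lra|nra]).
  lra. }
exists ((/ (1 - s)) ^ 2); intros n.
replace (INR n ^ 2 * q ^ n) with ((INR n * s ^ n) ^ 2).
2: { rewrite Rpow_mult_distr; f_equal; rewrite <- pow_mult, Nat.mul_comm, pow_mult.
  f_equal; unfold s; rewrite <- Rsqr_pow2; apply Rsqr_sqrt; lra. }
assert (P : 0 <= s ^ n) by (apply pow_le; lra).
assert (N := pos_INR n).
apply pow_incr; split; [now apply Rmult_le_pos|].
apply Rmult_le_reg_r with (1 - s); [lra|].
rewrite Rinv_l by lra; specialize (B n); lra.
Qed.

(** The weight [n^2] dominates both the derivative coefficients and the second-order remainders of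
    [z^n]. The bound at [s = (1 + r) / 2] absorbs it, since [(r / s)^n] decays geometrically. *)
Lemma disc_coeffs_nat_sqr (a : nat -> C) :
  disc_coeffs a -> disc_coeffs (fun n => RtoC (INR n ^ 2) * a n)%C.
Proof.
intros Ha r Hr.
set (s := (1 + r) / 2).
destruct (Ha s) as [M HM]; [unfold s; lra|].
destruct (nat_sqr_pow_bounded (r / s)) as [K HK].
{ split; [apply Rdiv_lt_0_compat; unfold s; lra|].
  apply Rmult_lt_reg_r with s; [unfold s; lra|].
  unfold Rdiv; rewrite Rmult_assoc, Rinv_l; unfold s; lra. }
exists (K * M); intros n.
rewrite Cmod_mult, Cmod_R, Rabs_pos_eq by apply pow2_ge_0.
replace (INR n ^ 2 * Cmod (a n) * r ^ n)
  with ((INR n ^ 2 * (r / s) ^ n) * (Cmod (a n) * s ^ n)).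
- apply Rmult_le_compat; trivial.
  + apply Rmult_le_pos; [apply pow2_ge_0|apply pow_le].
    left; apply Rdiv_lt_0_compat; unfold s; lra.
  + apply Rmult_le_pos; [apply Cmod_ge_0|apply pow_le; unfold s; lra].
- unfold Rdiv; rewrite Rpow_mult_distr, pow_inv; field.
  apply pow_nonzero; unfold s; lra.
Qed.

Lemma disc_coeffs_le (a b : nat -> C) :
  (forall n, Cmod (b n) <= Cmod (a n)) -> disc_coeffs a -> disc_coeffs b.
Proof.
intros H Ha r Hr; destruct (Ha r Hr) as [M HM]; exists M; intros n.
eapply Rle_trans; [|apply HM]; apply Rmult_le_compat_r; [apply pow_le; lra|apply H].
Qed.

Lemma disc_coeffs_shift (a : nat -> C) : disc_coeffs a -> disc_coeffs (fun n => a (S n)).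
Proof.
intros Ha r Hr; destruct (Ha r Hr) as [M HM]; exists (M / r); intros n.
apply Rmult_le_reg_r with r; [lra|].
unfold Rdiv; rewrite (Rmult_assoc M), Rinv_l by lra.
specialize (HM (S n)); simpl in HM; lra.
Qed.

Lemma disc_coeffs_unshift (a : nat -> C) : disc_coeffs (fun n => a (S n)) -> disc_coeffs a.
Proof.
intros Ha r Hr; destruct (Ha r Hr) as [M HM].
assert (P := Cmod_ge_0 (a 0%nat)).
exists (Rmax (Cmod (a 0%nat)) M); intros [|n].
- simpl; rewrite Rmult_1_r; apply Rmax_l.
- eapply Rle_trans; [|apply Rmax_r]; eapply Rle_trans; [|apply (HM n)]; simpl.
  assert (0 <= Cmod (a (S n)) * r ^ n) by (apply Rmult_le_pos; [apply Cmod_ge_0|apply pow_le; lra]).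
  nra.
Qed.

Lemma disc_coeffs_plus (a b : nat -> C) :
  disc_coeffs a -> disc_coeffs b -> disc_coeffs (fun n => a n + b n)%C.
Proof.
intros Ha Hb r Hr; destruct (Ha r Hr) as [M HM]; destruct (Hb r Hr) as [N HN].
exists (M + N); intros n.
eapply Rle_trans; [apply Rmult_le_compat_r; [apply pow_le; lra|apply Cmod_triangle]|].
rewrite Rmult_plus_distr_r; apply Rplus_le_compat; auto.
Qed.

Lemma disc_coeffs_scal (c : C) (a : nat -> C) :
  disc_coeffs a -> disc_coeffs (fun n => c * a n)%C.
Proof.
intros Ha r Hr; destruct (Ha r Hr) as [M HM].
exists (Cmod c * M); intros n; rewrite Cmod_mult, Rmult_assoc.
apply Rmult_le_compat_l; [apply Cmod_ge_0|auto].
Qed.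

Lemma ex_series_disc_coeffs (a : nat -> C) (r : R) :
  disc_coeffs a -> 0 <= r < 1 -> ex_series (fun n => Cmod (a n) * r ^ n).
Proof.
intros Ha Hr.
set (s := (1 + r) / 2).
destruct (Ha s) as [M HM]; [unfold s; lra|].
assert (Hq : 0 <= r / s < 1).
{ split; [apply Rdiv_le_0_compat; unfold s; lra|].
  apply Rmult_lt_reg_r with s; [unfold s; lra|].
  unfold Rdiv; rewrite Rmult_assoc, Rinv_l; unfold s; lra. }
apply (@ex_series_le R_AbsRing R_CompleteNormedModule _ (fun n => M * (r / s) ^ n)).
- intros n; change (Rabs (Cmod (a n) * r ^ n) <= M * (r / s) ^ n).
  rewrite Rabs_pos_eq by (apply Rmult_le_pos; [apply Cmod_ge_0|apply pow_le; lra]).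
  replace (Cmod (a n) * r ^ n) with ((Cmod (a n) * s ^ n) * (r / s) ^ n).
  + apply Rmult_le_compat_r; [apply pow_le; lra|apply HM].
  + unfold Rdiv; rewrite Rpow_mult_distr, pow_inv; field.
    apply pow_nonzero; unfold s; lra.
- apply (ex_series_scal_l (V := R_NormedModule) M (fun n => (r / s) ^ n)).
  apply ex_series_geom; rewrite Rabs_pos_eq; lra.
Qed.

Lemma cpser_correct (a : nat -> C) (z : C) :
  disc_coeffs a -> in_disc z -> Cseries (fun n => a n * cpow z n)%C (cpser a z).
Proof.
intros Ha Hz; apply ex_Cseries with (fun n => Cmod (a n) * Cmod z ^ n).
- intros n; rewrite Cmod_mult, Cmod_cpow; lra.
- apply ex_series_disc_coeffs; trivial; split; [apply Cmod_ge_0|exact Hz].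
Qed.

Lemma cpser_unique (a : nat -> C) (z l : C) :
  disc_coeffs a -> in_disc z -> Cseries (fun n => a n * cpow z n)%C l -> cpser a z = l.
Proof. intros Ha Hz; apply Cseries_unique; now apply cpser_correct. Qed.

(** Convergence at the real point [z = r] makes the terms tend to 0. From some index on both parts
    are below 1, hence the modulus is below 2; the finitely many earlier terms have a maximum. *)
Lemma Cseries_disc_coeffs (f : C -> C) (a : nat -> C) :
  (forall z, in_disc z -> Cseries (fun n => a n * cpow z n)%C (f z)) -> disc_coeffs a.
Proof.
intros H r Hr.
assert (Hz : in_disc (RtoC r)) by (unfold in_disc; rewrite Cmod_R, Rabs_pos_eq; lra).
assert (K := H _ Hz); apply Cseries_iff in K; destruct K as [K1 K2].
assert (L1 := ex_series_lim_0 _ (ex_intro _ _ K1)).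
assert (L2 := ex_series_lim_0 _ (ex_intro _ _ K2)).
apply is_lim_seq_spec in L1; apply is_lim_seq_spec in L2.
destruct (L1 (mkposreal 1 Rlt_0_1)) as [N1 B1]; destruct (L2 (mkposreal 1 Rlt_0_1)) as [N2 B2].
simpl in B1, B2.
assert (B : forall N, exists M, forall n, (n < N)%nat -> Cmod (a n) * r ^ n <= M).
{ induction N as [|N [M HM]]; [exists 0; intros; lia|].
  exists (Rmax M (Cmod (a N) * r ^ N)); intros n Hn.
  destruct (Nat.eq_dec n N) as [-> | E]; [apply Rmax_r|].
  eapply Rle_trans; [apply HM; lia|apply Rmax_l]. }
destruct (B (max N1 N2)) as [M HM].
exists (Rmax M 2); intros n.
destruct (Nat.lt_ge_cases n (max N1 N2)) as [Hn|Hn].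
- eapply Rle_trans; [now apply HM|apply Rmax_l].
- eapply Rle_trans; [|apply Rmax_r].
  specialize (B1 n ltac:(lia)); specialize (B2 n ltac:(lia)).
  rewrite Rminus_0_r in B1, B2.
  replace (Cmod (a n) * r ^ n) with (Cmod (a n * cpow r n)).
  + eapply Rle_trans; [apply Cmod_le_Rabs_fst_snd|]; simpl; lra.
  + rewrite Cmod_mult, Cmod_cpow, Cmod_R, Rabs_pos_eq; lra.
Qed.

Lemma in_disc_0 : in_disc 0.
Proof. unfold in_disc; rewrite Cmod_0; lra. Qed.

Lemma cpser_shift (a : nat -> C) (z : C) :
  disc_coeffs a -> in_disc z ->
  cpser a z = (a 0%nat + z * cpser (fun n => a (S n)) z)%C.
Proof.
intros Ha Hz; apply cpser_unique; trivial.
replace (a 0%nat + z * cpser (fun n => a (S n)) z)%C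
  with (a 0%nat * cpow z 0 + z * cpser (fun n => a (S n)) z)%C by (simpl; ring).
apply (proj1 (Cseries_shift (fun n => a n * cpow z n)%C _)).
apply Cseries_ext with (fun n => z * (a (S n) * cpow z n))%C; [intros n; simpl; ring|].
apply Cseries_scal, cpser_correct; trivial; now apply disc_coeffs_shift.
Qed.

Lemma cpser_0 (a : nat -> C) : disc_coeffs a -> cpser a 0 = a 0%nat.
Proof. intros Ha; rewrite cpser_shift by (trivial; apply in_disc_0); ring. Qed.

(** The derivative [n z^(n-1)], generated by the Leibniz rule for [z * z^k]. This form has no
    exponent [n - 1] and follows the induction for the Taylor remainder. *)
Fixpoint dcpow (z : C) (n : nat) : C :=
  match n with O => RtoC 0 | S k => (cpow z k + z * dcpow z k)%C end.

Lemma dcpow_S (z : C) (n : nat) : dcpow z (S n) = (RtoC (INR (S n)) * cpow z n)%C.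
Proof.
induction n; [simpl; ring|].
change (dcpow z (S (S n))) with (cpow z (S n) + z * dcpow z (S n))%C.
rewrite IHn, (S_INR (S n)), RtoC_plus; simpl; ring.
Qed.

(** One induction proves both estimates, because the step for the second uses the first. The factors
    [r] and [r^2] stand on the left to avoid the exponents [n - 1] and [n - 2]. *)
Lemma cpow_taylor (y z : C) (r : R) (n : nat) :
  Cmod y <= r -> Cmod z <= r ->
  r * Cmod (cpow y n - cpow z n) <= INR n * r ^ n * Cmod (y - z) /\
  r ^ 2 * Cmod (cpow y n - cpow z n - (y - z) * dcpow z n)
    <= INR n ^ 2 * r ^ n * Cmod (y - z) ^ 2.
Proof.
intros Hy Hz.
assert (Pd := Cmod_ge_0 (y - z)); assert (Pz := Cmod_ge_0 z); assert (Pr : 0 <= r) by lra.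
set (d := Cmod (y - z)) in *.
induction n as [|n [IH1 IH2]].
{ simpl; replace (1 - 1)%C with (RtoC 0) by ring.
  replace (0 - (y - z) * 0)%C with (RtoC 0) by ring; rewrite Cmod_0; lra. }
assert (Pn := pos_INR n); assert (Prn : 0 <= r ^ n) by now apply pow_le.
assert (Pnr : 0 <= r * r ^ n) by now apply Rmult_le_pos.
rewrite S_INR; split.
- replace (cpow y (S n) - cpow z (S n))%C
    with (z * (cpow y n - cpow z n) + (y - z) * cpow y n)%C by (simpl; ring).
  assert (Cmod (z * (cpow y n - cpow z n) + (y - z) * cpow y n)
          <= r * Cmod (cpow y n - cpow z n) + d * r ^ n).
  { eapply Rle_trans; [apply Cmod_triangle|]; rewrite !Cmod_mult, Cmod_cpow.
    apply Rplus_le_compat.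
    - apply Rmult_le_compat_r; [apply Cmod_ge_0|lra].
    - apply Rmult_le_compat_l; [lra|apply pow_incr; split; [apply Cmod_ge_0|lra]]. }
  assert (r * (r * Cmod (cpow y n - cpow z n)) <= r * (INR n * r ^ n * d))
    by (apply Rmult_le_compat_l; lra).
  assert (r * Cmod (z * (cpow y n - cpow z n) + (y - z) * cpow y n)
     <= r * (r * Cmod (cpow y n - cpow z n) + d * r ^ n)) by (apply Rmult_le_compat_l; lra).
  simpl; lra.
- replace (cpow y (S n) - cpow z (S n) - (y - z) * dcpow z (S n))%C
    with (z * (cpow y n - cpow z n - (y - z) * dcpow z n) + (y - z) * (cpow y n - cpow z n))%C
    by (simpl; ring).
  set (E := (cpow y n - cpow z n - (y - z) * dcpow z n)%C) in *.
  set (D := (cpow y n - cpow z n)%C) in *.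
  assert (H : Cmod (z * E + (y - z) * D) <= r * Cmod E + d * Cmod D).
  { eapply Rle_trans; [apply Cmod_triangle|]; rewrite !Cmod_mult; fold d.
    apply Rplus_le_compat_r, Rmult_le_compat_r; [apply Cmod_ge_0|lra]. }
  apply Rle_trans with (r * (r ^ 2 * Cmod E) + r * d * (r * Cmod D)).
  { replace (r * (r ^ 2 * Cmod E) + r * d * (r * Cmod D))
      with (r ^ 2 * (r * Cmod E + d * Cmod D)) by ring.
    apply Rmult_le_compat_l; [apply pow2_ge_0|exact H]. }
  apply Rle_trans with (r * (INR n ^ 2 * r ^ n * d ^ 2) + r * d * (INR n * r ^ n * d)).
  { apply Rplus_le_compat; apply Rmult_le_compat_l; trivial; now apply Rmult_le_pos. }
  replace (r * (INR n ^ 2 * r ^ n * d ^ 2) + r * d * (INR n * r ^ n * d))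
    with ((INR n ^ 2 + INR n) * (r * r ^ n * d ^ 2)) by ring.
  replace ((INR n + 1) ^ 2 * r ^ S n * d ^ 2)
    with ((INR n + 1) ^ 2 * (r * r ^ n * d ^ 2)) by (simpl; ring).
  apply Rmult_le_compat_r; [apply Rmult_le_pos; trivial; apply pow2_ge_0|nra].
Qed.

Definition deriv_coeffs (a : nat -> C) (n : nat) : C := (RtoC (INR (S n)) * a (S n))%C.

Lemma disc_coeffs_deriv (a : nat -> C) : disc_coeffs a -> disc_coeffs (deriv_coeffs a).
Proof.
intros Ha; apply disc_coeffs_le with (fun n => RtoC (INR (S n) ^ 2) * a (S n))%C.
- intros n; unfold deriv_coeffs; rewrite !Cmod_mult, !Cmod_R.
  apply Rmult_le_compat_r; [apply Cmod_ge_0|].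
  assert (P := pos_INR n); rewrite S_INR, !Rabs_pos_eq by nra; nra.
- apply (disc_coeffs_shift (fun n => RtoC (INR n ^ 2) * a n)%C).
  now apply disc_coeffs_nat_sqr.
Qed.

(** Termwise differentiation: with [r = (1 + |z|) / 2], summing the second-order remainders of the
    powers bounds that of the series by [|y - z|^2 / r^2 * K], where [K] is the sum of
    [n^2 |a_n| r^n]. *)
Lemma has_cderiv_cpser (a : nat -> C) (z : C) :
  disc_coeffs a -> in_disc z -> has_cderiv (cpser a) z (cpser (deriv_coeffs a) z).
Proof.
intros Ha Hz; unfold in_disc in Hz.
assert (Pz := Cmod_ge_0 z).
set (r := (1 + Cmod z) / 2).
assert (Hr : 0 < r < 1) by (unfold r; lra).
destruct (ex_series_disc_coeffs _ r (disc_coeffs_nat_sqr a Ha) ltac:(lra)) as [K HK].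
assert (HD : Cseries (fun n => a n * dcpow z n)%C (cpser (deriv_coeffs a) z)).
{ replace (cpser (deriv_coeffs a) z) with (a 0%nat * dcpow z 0 + cpser (deriv_coeffs a) z)%C
    by (simpl; ring).
  apply (proj1 (Cseries_shift (fun n => a n * dcpow z n)%C _)).
  apply Cseries_ext with (fun n => deriv_coeffs a n * cpow z n)%C.
  - intros n; rewrite dcpow_S; unfold deriv_coeffs; ring.
  - apply cpser_correct; [now apply disc_coeffs_deriv|exact Hz]. }
assert (B : forall y, Cmod y <= r ->
  Cmod (cpser a y - cpser a z - (y - z) * cpser (deriv_coeffs a) z)
    <= Cmod (y - z) ^ 2 / r ^ 2 * K).
{ intros y Hy.
  apply (Cseries_norm_le
    (fun n => a n * (cpow y n - cpow z n - (y - z) * dcpow z n))%C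
    (fun n => Cmod (y - z) ^ 2 / r ^ 2 * (Cmod (RtoC (INR n ^ 2) * a n) * r ^ n))).
  - assert (S1 := cpser_correct a y Ha ltac:(unfold in_disc; lra)).
    assert (S2 := cpser_correct a z Ha Hz).
    assert (S3 := Cseries_plus _ _ _ _ S1
      (Cseries_plus _ _ _ _ (Cseries_scal (- (1)) _ _ S2) (Cseries_scal (- (y - z)) _ _ HD))).
    replace (cpser a y - cpser a z - (y - z) * cpser (deriv_coeffs a) z)%C
      with (cpser a y + (- (1) * cpser a z + - (y - z) * cpser (deriv_coeffs a) z))%C by ring.
    eapply Cseries_ext; [|exact S3]; intros n; simpl; ring.
  - intros n; rewrite !Cmod_mult, Cmod_R, Rabs_pos_eq by apply pow2_ge_0.
    destruct (cpow_taylor y z r n Hy ltac:(unfold r; lra)) as [_ T].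
    replace (Cmod (y - z) ^ 2 / r ^ 2 * (INR n ^ 2 * Cmod (a n) * r ^ n))
      with (Cmod (a n) * (INR n ^ 2 * r ^ n * Cmod (y - z) ^ 2 / r ^ 2)) by (field; lra).
    apply Rmult_le_compat_l; [apply Cmod_ge_0|].
    apply Rmult_le_reg_l with (r ^ 2); [nra|].
    replace (r ^ 2 * (INR n ^ 2 * r ^ n * Cmod (y - z) ^ 2 / r ^ 2))
      with (INR n ^ 2 * r ^ n * Cmod (y - z) ^ 2) by (field; lra); exact T.
  - apply (is_series_scal_l (V := R_NormedModule)); exact HK. }
assert (PK : 0 <= K).
{ eapply Rle_trans; [apply Cmod_ge_0|].
  assert (Hr' : Cmod r = r) by (rewrite Cmod_R, Rabs_pos_eq; lra).
  eapply (Cseries_norm_le _ _ _ K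
    (cpser_correct _ (RtoC r) (disc_coeffs_nat_sqr a Ha) ltac:(unfold in_disc; lra)));
    [|exact HK].
  intros n; rewrite Cmod_mult, Cmod_cpow, Hr'; apply Rle_refl. }
apply has_cderiv_iff; intros eps He.
set (c := K / r ^ 2).
assert (Pc : 0 <= c) by (apply Rdiv_le_0_compat; [exact PK|nra]).
exists (Rmin ((1 - Cmod z) / 2) (eps / (c + 1))); split.
{ apply Rmin_pos; [lra|apply Rdiv_lt_0_compat; lra]. }
intros y Hy.
assert (Y1 : Cmod (y - z) < (1 - Cmod z) / 2) by (eapply Rlt_le_trans; [exact Hy|apply Rmin_l]).
assert (Y2 : Cmod (y - z) < eps / (c + 1)) by (eapply Rlt_le_trans; [exact Hy|apply Rmin_r]).
assert (Yr : Cmod y <= r).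
{ replace y with (z + (y - z))%C by ring.
  eapply Rle_trans; [apply Cmod_triangle|]; unfold r; lra. }
eapply Rle_trans; [apply (B y Yr)|].
assert (Pd := Cmod_ge_0 (y - z)); set (d := Cmod (y - z)) in *.
replace (d ^ 2 / r ^ 2 * K) with (c * d * d) by (unfold c; field; lra).
apply Rmult_le_compat_r; trivial.
apply Rmult_lt_compat_r with (r := c + 1) in Y2; [|lra].
replace (eps / (c + 1) * (c + 1)) with eps in Y2 by (field; lra); nra.
Qed.

(** * Exponentials of power series *)

(** Along the segment from 0 to [z], the real and imaginary parts of [h] have zero derivative in the
    real parameter. *)
Lemma zero_cderiv_constant (h : C -> C) (z : C) :
  (forall y, in_disc y -> has_cderiv h y 0) -> in_disc z -> h z = h 0.
Proof.
intros Hh Hz.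
assert (HD : forall t, 0 <= t <= 1 -> has_cderiv h (t * fst z, t * snd z) 0).
{ intros t Ht; apply Hh; unfold in_disc.
  replace (t * fst z, t * snd z) with (t * z)%C
    by (apply injective_projections; simpl; ring).
  rewrite Cmod_mult, Cmod_R, Rabs_pos_eq by lra.
  unfold in_disc in Hz; assert (P := Cmod_ge_0 z); nra. }
assert (HL : forall t, derivable_pt_lim (fun t => t * fst z) t (fst z) /\
                       derivable_pt_lim (fun t => t * snd z) t (snd z)).
{ intros t; split; apply is_derive_Reals; auto_derive; trivial; ring. }
assert (E0 : (0 * fst z, 0 * snd z) = RtoC 0) by (rewrite !Rmult_0_l; reflexivity).
assert (E1 : (1 * fst z, 1 * snd z) = z) by (rewrite !Rmult_1_l; now destruct z).
rewrite <- E0; rewrite <- E1 at 1; symmetry.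
apply injective_projections.
- apply (eq_is_derive (fun t => fst (h (t * fst z, t * snd z))) 0 1); [|lra].
  intros t Ht; apply is_derive_Reals.
  destruct (has_cderiv_differentiable h _ _ _ (HD t Ht)) as [D _]; simpl in D.
  assert (Q := derivable_pt_lim_comp_2d (fun s t => fst (h (s, t))) _ _ t _ _ _ _ D
    (proj1 (HL t)) (proj2 (HL t))).
  replace (0 * fst z + - 0 * snd z) with 0 in Q by ring; exact Q.
- apply (eq_is_derive (fun t => snd (h (t * fst z, t * snd z))) 0 1); [|lra].
  intros t Ht; apply is_derive_Reals.
  destruct (has_cderiv_differentiable h _ _ _ (HD t Ht)) as [_ D]; simpl in D.
  assert (Q := derivable_pt_lim_comp_2d (fun s t => snd (h (s, t))) _ _ t _ _ _ _ D
    (proj1 (HL t)) (proj2 (HL t))).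
  replace (0 * fst z + 0 * snd z) with 0 in Q by ring; exact Q.
Qed.

(* Solves [(n + 1) a_(n+1) = sum_(j <= n) a_j p_(n-j)], [a_0 = 1], that is
   [g' = g p], [g 0 = 1]; only the entries of index at most [n] are meaningful. *)
Fixpoint ode_table (p : nat -> C) (n : nat) : nat -> C :=
  match n with
  | O => fun _ => RtoC 1
  | S k => fun m => if Nat.leb m k then ode_table p k m else
      (RtoC (/ INR (S k)) *
       @sum_n C_NormedModule (fun j => ode_table p k j * p (k - j)%nat)%C k)%C
  end.

Definition ode_coeffs (p : nat -> C) (n : nat) : C := ode_table p n n.

Lemma ode_table_stable (p : nat -> C) (n m : nat) :
  (m <= n)%nat -> ode_table p n m = ode_coeffs p m.
Proof.
induction n as [|n IH]; intros Hm.
- now replace m with 0%nat by lia.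
- destruct (Nat.eq_dec m (S n)) as [-> | E]; [reflexivity|].
  simpl; rewrite (proj2 (Nat.leb_le m n)) by lia; apply IH; lia.
Qed.

Lemma ode_coeffs_S (p : nat -> C) (n : nat) :
  (RtoC (INR (S n)) * ode_coeffs p (S n))%C =
  @sum_n C_NormedModule (fun j => ode_coeffs p j * p (n - j)%nat)%C n.
Proof.
unfold ode_coeffs at 1; cbn [ode_table].
rewrite (proj2 (Nat.leb_gt (S n) n)) by lia.
rewrite Cmult_assoc, <- RtoC_mult, Rinv_r, Cmult_1_l by (apply not_0_INR; lia).
apply (sum_n_ext_loc (G := C_NormedModule)); intros k Hk.
now rewrite ode_table_stable.
Qed.

Lemma Cmod_sum_n_le (f : nat -> C) (n : nat) :
  Cmod (@sum_n C_NormedModule f n) <= sum_n (fun k => Cmod (f k)) n.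
Proof.
induction n; [rewrite !sum_O; lra|].
rewrite !sum_Sn; eapply Rle_trans; [apply Cmod_triangle|].
apply Rplus_le_compat_r, IHn.
Qed.

(** Put [r = s^2], [|p_n| s^n <= M], [b_n = |a_n| s^n] and let [T_n] be the partial sums of [b]. The
    recurrence gives [(n + 1) b_(n+1) <= M T_n], so [T] grows at most by the factor
    [1 + M / (n + 1)], which is eventually below [1 / s]. Hence [T_n s^n] is eventually
    nonincreasing, and it dominates [|a_n| r^n = b_n s^n]. *)
Lemma disc_coeffs_ode (p : nat -> C) : disc_coeffs p -> disc_coeffs (ode_coeffs p).
Proof.
intros Hp r Hr.
set (s := sqrt r).
assert (Ess : s * s = r) by (apply sqrt_sqrt; lra).
assert (Hs : 0 < s < 1).
{ unfold s; split; [apply sqrt_lt_R0; lra|]; rewrite <- sqrt_1; apply sqrt_lt_1_alt; lra. }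
destruct (Hp s Hs) as [M HM].
assert (PM : 0 <= M).
{ specialize (HM 0%nat); simpl in HM; assert (P := Cmod_ge_0 (p 0%nat)); lra. }
set (a := ode_coeffs p); set (b := fun n => Cmod (a n) * s ^ n).
assert (Pb : forall n, 0 <= b n)
  by (intros n; apply Rmult_le_pos; [apply Cmod_ge_0|apply pow_le; lra]).
set (T := sum_n b).
assert (TS : forall n, T (S n) = T n + b (S n)) by (intros n; exact (sum_Sn b n)).
assert (bT : forall n, b n <= T n).
{ assert (PT : forall n, 0 <= T n).
  { induction n; [unfold T; rewrite sum_O; apply Pb|].
    rewrite TS; specialize (Pb (S n)); lra. }
  intros [|n]; [unfold T; rewrite sum_O; lra|rewrite TS; specialize (PT n); lra]. }
assert (Hrec : forall n, INR (S n) * b (S n) <= M * T n).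
{ intros n.
  assert (E : INR (S n) * Cmod (a (S n))
     <= sum_n (fun j => Cmod (a j * p (n - j)%nat)) n).
  { eapply Rle_trans; [|apply Cmod_sum_n_le].
    unfold a; rewrite <- ode_coeffs_S, Cmod_mult, Cmod_R, Rabs_pos_eq; [lra|apply pos_INR]. }
  apply Rmult_le_compat_r with (r := s ^ n) in E; [|apply pow_le; lra].
  assert (E2 : sum_n (fun j => Cmod (a j * p (n - j)%nat)) n * s ^ n <= M * T n).
  { set (c := fun j => Cmod (a j * p (n - j)%nat)).
    assert (EL : sum_n (fun j => c j * s ^ n) n = sum_n c n * s ^ n)
      by exact (sum_n_mult_r (K := R_Ring) (s ^ n) c n).
    assert (ER : sum_n (fun j => M * b j) n = M * T n)
      by exact (sum_n_mult_l (K := R_Ring) M b n).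
    rewrite <- EL, <- ER; unfold c.
    rewrite !sum_n_Reals; apply sum_Rle; intros j Hj.
    change (Cmod (a j * p (n - j)%nat) * s ^ n <= M * b j).
    replace (s ^ n) with (s ^ (n - j) * s ^ j) by (rewrite <- pow_add; f_equal; lia).
    rewrite Cmod_mult; unfold b.
    replace (Cmod (a j) * Cmod (p (n - j)%nat) * (s ^ (n - j) * s ^ j))
      with (Cmod (p (n - j)%nat) * s ^ (n - j) * (Cmod (a j) * s ^ j)) by ring.
    apply Rmult_le_compat_r; [apply Pb|apply HM]. }
  assert (0 <= INR (S n) * b (S n)) by (apply Rmult_le_pos; [apply pos_INR|apply Pb]).
  assert (Hb : INR (S n) * b (S n) = s * (INR (S n) * Cmod (a (S n)) * s ^ n))
    by (unfold b; simpl pow; ring).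
  assert (0 <= INR (S n) * Cmod (a (S n)) * s ^ n) by
    (apply Rmult_le_pos; [apply Rmult_le_pos; [apply pos_INR|apply Cmod_ge_0]|apply pow_le; lra]).
  rewrite Hb; nra. }
(* From [N] on, [M s / (n + 1) <= 1 - s], which is exactly [s * (1 + M / (n + 1)) <= 1]. *)
destruct (INR_unbounded (M * s / (1 - s))) as [N HN].
assert (HN' : M * s <= INR N * (1 - s)).
{ apply Rmult_gt_compat_r with (r := 1 - s) in HN; [|lra].
  replace (M * s / (1 - s) * (1 - s)) with (M * s) in HN by (field; lra); lra. }
assert (PT : forall n, 0 <= T n) by (intros n; eapply Rle_trans; [apply Pb|apply bT]).
assert (B1 : forall k, T (N + k)%nat * s ^ (N + k) <= T N).
{ induction k as [|k IH].
  - rewrite Nat.add_0_r; assert (s ^ N <= 1) by (rewrite <- (pow1 N); apply pow_incr; lra).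
    specialize (PT N); nra.
  - rewrite Nat.add_succ_r, TS; set (n := (N + k)%nat) in *.
    eapply Rle_trans; [|exact IH].
    simpl pow; rewrite <- Rmult_assoc; apply Rmult_le_compat_r; [apply pow_le; lra|].
    specialize (Hrec n); specialize (PT n).
    assert (Hn : INR N <= INR (S n)) by (apply le_INR; unfold n; lia).
    assert (Hn0 : 0 < INR (S n)) by (apply lt_0_INR; lia).
    assert (s * (INR (S n) * b (S n)) <= s * (M * T n)) by (apply Rmult_le_compat_l; lra).
    assert (M * s * T n <= INR (S n) * (1 - s) * T n).
    { apply Rmult_le_compat_r; trivial; eapply Rle_trans; [exact HN'|].
      apply Rmult_le_compat_r; lra. }
    apply Rmult_le_reg_l with (INR (S n)); trivial; lra. }
assert (B2 : forall n, (n <= N)%nat -> T n <= T N).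
{ intros n Hn; replace N with (n + (N - n))%nat by lia.
  induction (N - n)%nat as [|k IH]; [rewrite Nat.add_0_r; lra|].
  rewrite Nat.add_succ_r, TS; specialize (Pb (S (n + k))); lra. }
exists (T N); intros n.
replace (Cmod (a n) * r ^ n) with (b n * s ^ n)
  by (unfold b; rewrite <- Ess, Rpow_mult_distr; ring).
assert (Ps : 0 <= s ^ n) by (apply pow_le; lra).
apply Rle_trans with (T n * s ^ n); [apply Rmult_le_compat_r; trivial|].
destruct (Nat.le_ge_cases n N) as [Hn|Hn].
- apply Rle_trans with (T n); [|now apply B2].
  assert (s ^ n <= 1) by (rewrite <- (pow1 n); apply pow_incr; lra).
  specialize (PT n); nra.
- replace n with (N + (n - N))%nat by lia; apply B1.
Qed.

(** Read as a Cauchy product, the recurrence says that the series [g] on the left satisfies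
    [g' = g P']. Then [g exp (- P)] has zero derivative and equals 1 at the origin, where [P]
    vanishes. *)
Lemma cexp_cpser (P : nat -> C) (z : C) :
  disc_coeffs P -> P 0%nat = RtoC 0 -> in_disc z ->
  cpser (ode_coeffs (deriv_coeffs P)) z = cexp (cpser P z).
Proof.
intros HP P0 Hz.
set (p := deriv_coeffs P); set (a := ode_coeffs p).
assert (Hp : disc_coeffs p) by now apply disc_coeffs_deriv.
assert (Ha : disc_coeffs a) by now apply disc_coeffs_ode.
assert (Hda : forall y, in_disc y -> cpser (deriv_coeffs a) y = (cpser a y * cpser p y)%C).
{ intros y Hy; apply cpser_unique; trivial; [now apply disc_coeffs_deriv|].
  assert (A : forall c, disc_coeffs c -> ex_series (fun n => Cmod (c n * cpow y n))).
  { intros c Hc; eapply ex_series_ext;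
      [|apply (ex_series_disc_coeffs c (Cmod y) Hc); split; [apply Cmod_ge_0|exact Hy]].
    intros n; now rewrite Cmod_mult, Cmod_cpow. }
  eapply Cseries_ext; [|exact (Cseries_mult _ _ _ _ (cpser_correct a y Ha Hy)
    (cpser_correct p y Hp Hy) (A a Ha) (A p Hp))].
  intros n; unfold deriv_coeffs.
  rewrite (ode_coeffs_S p n : (RtoC (INR (S n)) * a (S n))%C = _), Cmult_comm.
  symmetry; etransitivity;
    [symmetry; exact (sum_n_mult_l (K := C_Ring) (cpow y n) (fun j => a j * p (n - j)%nat)%C n)|].
  apply (sum_n_ext_loc (G := C_NormedModule)); intros k Hk.
  assert (E : cpow y n = (cpow y k * cpow y (n - k))%C) by (rewrite <- cpow_add; f_equal; lia).
  change (cpow y n * (a k * p (n - k)%nat)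
    = a k * cpow y k * (p (n - k)%nat * cpow y (n - k)))%C; rewrite E; ring. }
assert (Hh : (cpser a z * cexp (- (1) * cpser P z))%C = RtoC 1).
{ rewrite (zero_cderiv_constant (fun y => cpser a y * cexp (- (1) * cpser P y))%C z); trivial.
  - rewrite !cpser_0, P0 by trivial.
    replace (- (1) * 0)%C with (RtoC 0) by ring; rewrite cexp_0; unfold a, ode_coeffs; simpl; ring.
  - intros y Hy; eapply has_cderiv_eq.
    + apply has_cderiv_mult; [now apply has_cderiv_cpser|].
      apply (has_cderiv_comp cexp (fun y => - (1) * cpser P y)%C); [apply has_cderiv_cexp|].
      apply has_cderiv_scal; now apply has_cderiv_cpser.
    + rewrite Hda by trivial; fold p; ring. }
rewrite <- (Cmult_1_r (cpser a z)), <- cexp_0.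
replace (RtoC 0) with (- (1) * cpser P z + cpser P z)%C by ring.
rewrite cexp_plus, Cmult_assoc, Hh; ring.
Qed.

(** * Expansion of the subordinating function *)

Lemma tends0_cpser (a : nat -> C) : disc_coeffs a -> tends0 (cpser a) (a 0%nat).
Proof.
intros Ha eps He.
destruct (has_cderiv_continuous _ _ _ eps (has_cderiv_cpser a 0 Ha in_disc_0) He) as [d [Hd H]].
exists d; split; trivial; intros z _ Hz; rewrite <- (cpser_0 a Ha); apply H.
replace (z - 0)%C with z by ring; exact Hz.
Qed.

(** This is [sinh (u / 2)]. Since [cosh u - 1] is twice its square, the first derivative of [w] at 0
    already determines the second-order term of [cosh w]. *)
Definition half_sinh (u : C) : C :=
  (RtoC (/ 2) * (cexp (RtoC (/ 2) * u) - cexp (RtoC (- / 2) * u)))%C.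

Lemma phi_ch_half_sinh (u : C) :
  phi_ch u = (1 + u + 2 * (half_sinh u * half_sinh u))%C.
Proof.
unfold phi_ch, ccosh, half_sinh.
assert (H2 : (RtoC 2 * RtoC (/ 2))%C = RtoC 1) by (rewrite <- RtoC_mult; f_equal; lra).
assert (E1 : cexp u = (cexp (RtoC (/ 2) * u) * cexp (RtoC (/ 2) * u))%C).
{ rewrite <- cexp_plus; f_equal; transitivity (RtoC 2 * RtoC (/ 2) * u)%C; [rewrite H2|]; ring. }
assert (E2 : cexp (- u) = (cexp (RtoC (- / 2) * u) * cexp (RtoC (- / 2) * u))%C).
{ rewrite <- cexp_plus; f_equal; rewrite RtoC_opp.
  transitivity (- (RtoC 2 * RtoC (/ 2) * u))%C; [rewrite H2|]; ring. }
assert (E3 : (cexp (RtoC (/ 2) * u) * cexp (RtoC (- / 2) * u))%C = RtoC 1).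
{ rewrite <- cexp_plus, <- cexp_0; f_equal; rewrite RtoC_opp; ring. }
rewrite E1, E2.
set (A := cexp (RtoC (/ 2) * u)) in *; set (B := cexp (RtoC (- / 2) * u)) in *.
set (h := RtoC (/ 2)) in *.
transitivity (1 + u + (2 * h) * (h * (A * A + B * B) - (2 * h) * (A * B)))%C; [|ring].
rewrite H2, E3; ring.
Qed.

Lemma has_cderiv_half_sinh (u : C -> C) (z l : C) :
  has_cderiv u z l -> u z = RtoC 0 -> has_cderiv (fun x => half_sinh (u x)) z (RtoC (/ 2) * l)%C.
Proof.
intros Hu Hz; unfold half_sinh.
assert (H : forall k : R, has_cderiv (fun x => cexp (RtoC k * u x)) z (RtoC k * l)%C).
{ intros k; eapply has_cderiv_eq.
  - apply (has_cderiv_comp cexp (fun x => RtoC k * u x)%C); [apply has_cderiv_cexp|].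
    apply has_cderiv_scal, Hu.
  - now rewrite Hz, Cmult_0_r, cexp_0, Cmult_1_r. }
eapply has_cderiv_eq; [apply has_cderiv_scal, has_cderiv_minus; apply H|].
rewrite RtoC_opp.
assert (H2 : (RtoC 2 * RtoC (/ 2))%C = RtoC 1) by (rewrite <- RtoC_mult; f_equal; lra).
transitivity (RtoC (/ 2) * ((RtoC 2 * RtoC (/ 2)) * l))%C; [ring|rewrite H2; ring].
Qed.

Lemma has_cderiv_of_coeffs (f : C -> C) (a : nat -> C) (z : C) :
  (forall y, in_disc y -> Cseries (fun n => a n * cpow y n)%C (f y)) ->
  in_disc z -> has_cderiv f z (cpser (deriv_coeffs a) z).
Proof.
intros Hf Hz; assert (Ha := Cseries_disc_coeffs f a Hf).
unfold in_disc in *.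
apply (has_cderiv_ext_loc (cpser a)) with (d := 1 - Cmod z); [lra| |now apply has_cderiv_cpser].
intros y Hy; assert (Hy' : Cmod y < 1).
{ replace y with (z + (y - z))%C by ring.
  eapply Rle_lt_trans; [apply Cmod_triangle|]; lra. }
apply cpser_unique; trivial; now apply Hf.
Qed.

(* With [f = z E] and [f' = D] the quotient is [D / E], and [cosh w = 1 + 2 sinh^2 (w / 2)],
   so [w = (D - E) / E - 2 sinh^2 (w / 2)] yields its second-order expansion. *)
Lemma schwarz_function_expansion (f w : C -> C) (a : nat -> C) (c1 : C) :
  in_A_with_coeffs f a ->
  (forall z, in_disc z -> z <> RtoC 0 -> f z <> RtoC 0) ->
  has_cderiv w 0 c1 -> w 0 = RtoC 0 ->
  (forall z, in_disc z -> Sch_quotient f z = phi_ch (w z)) ->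
  c1 = a 2%nat /\
  tends0 (fun z => (w z - c1 * z) / (z * z))%C
    (RtoC 2 * a 3%nat - RtoC (3 / 2) * (a 2%nat * a 2%nat))%C.
Proof.
intros [a0 [a1 Hf]] Hf0 Hw w0 Hq.
assert (Ha := Cseries_disc_coeffs f a Hf).
assert (Hd := disc_coeffs_deriv a Ha).
set (d := deriv_coeffs a) in *.
(* Successive remainders: [f = z E1], [E1 = 1 + z E2], [E2 = a2 + z E3], and [f' = 1 + z D2],
   [D2 = 2 a2 + z D3]. Each tends at 0 to its leading coefficient. *)
set (E1 := cpser (fun n => a (S n))); set (E2 := cpser (fun n => a (S (S n)))).
set (E3 := cpser (fun n => a (S (S (S n))))).
set (D2 := cpser (fun n => d (S n))); set (D3 := cpser (fun n => d (S (S n)))).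
assert (Ha1 := disc_coeffs_shift _ Ha); assert (Ha2 := disc_coeffs_shift _ Ha1).
assert (Ha3 := disc_coeffs_shift _ Ha2).
assert (Hd1 := disc_coeffs_shift _ Hd); assert (Hd2 := disc_coeffs_shift _ Hd1).
assert (d0 : d 0%nat = RtoC 1).
{ unfold d, deriv_coeffs; rewrite a1; simpl; ring. }
assert (d1 : d 1%nat = (2 * a 2%nat)%C).
{ unfold d, deriv_coeffs; replace (INR 2) with 2 by (simpl; ring); reflexivity. }
assert (d2 : d 2%nat = (3 * a 3%nat)%C).
{ unfold d, deriv_coeffs; replace (INR 3) with 3 by (simpl; ring); reflexivity. }
assert (TE1 : tends0 E1 1) by (rewrite <- a1; now apply tends0_cpser).
assert (TE2 : tends0 E2 (a 2%nat)) by now apply (tends0_cpser (fun n => a (S (S n)))).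
assert (TE3 : tends0 E3 (a 3%nat)) by now apply (tends0_cpser (fun n => a (S (S (S n))))).
assert (TD2 : tends0 D2 (2 * a 2%nat)) by (rewrite <- d1; now apply (tends0_cpser (fun n => d (S n)))).
assert (TD3 : tends0 D3 (3 * a 3%nat)) by (rewrite <- d2; now apply (tends0_cpser (fun n => d (S (S n))))).
assert (EE1 : forall z, in_disc z -> E1 z = (1 + z * E2 z)%C).
{ intros z Hz; rewrite <- a1; now apply (cpser_shift (fun n => a (S n))). }
assert (EE2 : forall z, in_disc z -> E2 z = (a 2%nat + z * E3 z)%C).
{ intros z Hz; now apply (cpser_shift (fun n => a (S (S n)))). }
assert (ED : forall z, in_disc z -> cpser d z = (1 + z * D2 z)%C).
{ intros z Hz; rewrite <- d0; now apply (cpser_shift d). }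
assert (ED2 : forall z, in_disc z -> D2 z = (2 * a 2%nat + z * D3 z)%C).
{ intros z Hz; rewrite <- d1; now apply (cpser_shift (fun n => d (S n))). }
assert (Ef : forall z, in_disc z -> f z = (z * E1 z)%C).
{ intros z Hz; rewrite <- (cpser_unique a z (f z) Ha Hz (Hf z Hz)), cpser_shift, a0 by trivial.
  fold E1; ring. }
assert (NE : forall z, in_disc z -> z <> RtoC 0 -> E1 z <> RtoC 0).
{ intros z Hz Hz0 E; apply (Hf0 z Hz Hz0); rewrite Ef, E by trivial; ring. }
set (s := fun z => half_sinh (w z)).
assert (s0 : s 0 = RtoC 0).
{ unfold s, half_sinh; rewrite w0, !Cmult_0_r; ring. }
assert (Ts : tends0 (fun z => s z / z)%C (RtoC (/ 2) * c1)%C).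
{ assert (T := tends0_quotient s _ (has_cderiv_half_sinh w 0 c1 Hw w0)); rewrite s0 in T.
  eapply tends0_ext; [|exact T]; exists 1; split; [lra|]; intros z Hz _; field; trivial. }
assert (Tw : tends0 (fun z => w z / z)%C c1).
{ assert (T := tends0_quotient w _ Hw); rewrite w0 in T.
  eapply tends0_ext; [|exact T]; exists 1; split; [lra|]; intros z Hz _; field; trivial. }
assert (Ew : forall z, in_disc z -> z <> RtoC 0 ->
  w z = ((cpser d z - E1 z) / E1 z - 2 * (s z * s z))%C).
{ intros z Hz Hz0; specialize (Hq z Hz); rewrite phi_ch_half_sinh in Hq; fold (s z) in Hq.
  unfold Sch_quotient in Hq; destruct (Req_EM_T (Cmod z) 0) as [E|_].
  { now apply Cmod_eq_0 in E. }
  rewrite (is_C_derive_unique f z (cpser d z)) in Hq by now apply has_cderiv_of_coeffs.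
  rewrite Ef in Hq by trivial.
  replace (w z) with ((1 + w z + 2 * (s z * s z)) - 1 - 2 * (s z * s z))%C by ring.
  rewrite <- Hq; field; split; [now apply NE|trivial]. }
assert (TI : tends0 (fun z => / E1 z)%C (/ 1)%C).
{ apply (tends0_comp Cinv E1 1 _ (has_cderiv_inv 1 ltac:(intros E; apply RtoC_inj in E; lra)) TE1). }
assert (I1 : (/ 1)%C = RtoC 1) by (field; intros E; apply RtoC_inj in E; lra).
rewrite I1 in TI.
assert (Hc : c1 = a 2%nat).
{ apply (tends0_unique (fun z => w z / z)%C); trivial.
  apply tends0_ext with (fun z => (D2 z - E2 z) * / E1 z - 2 * ((s z / z) * (s z / z)) * z)%C.
  - exists 1; split; [lra|]; intros z Hz0 Hz; rewrite Ew by trivial.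
    assert (N := NE z Hz Hz0); rewrite ED, (EE1 z) in * by trivial; field; now split.
  - eapply tends0_eq.
    { apply tends0_minus; [apply tends0_mult; [apply tends0_minus; [exact TD2|exact TE2]|exact TI]|].
      apply tends0_mult; [apply tends0_mult; [apply tends0_const|apply tends0_mult; exact Ts]|apply tends0_id]. }
    ring. }
split; [exact Hc|].
(* After [c1 = a2], the numerator [D2 - E2 - a2 E1] equals [z (D3 - E3 - a2 E2)], which cancels the
   second factor [z]. The limit is [3 a3 - a3 - a2^2 - 2 (a2 / 2)^2]. *)
apply tends0_ext with (fun z =>
  (D3 z - E3 z - a 2%nat * E2 z) * / E1 z - 2 * ((s z / z) * (s z / z)))%C.
- exists 1; split; [lra|]; intros z Hz0 Hz; rewrite Ew, Hc by trivial.
  assert (N := NE z Hz Hz0); rewrite ED, ED2 by trivial.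
  assert (F2 := EE2 z Hz); assert (F1 := EE1 z Hz).
  rewrite F2 in F1; rewrite F1 in *; rewrite F2; field; now split.
- eapply tends0_eq.
  { apply tends0_minus; [apply tends0_mult; [apply tends0_minus; [apply tends0_minus;
      [exact TD3|exact TE3]|apply tends0_mult; [apply tends0_const|exact TE2]]|exact TI]|].
    apply tends0_mult; [apply tends0_const|apply tends0_mult; exact Ts]. }
  rewrite Hc; replace (RtoC (3 / 2)) with (1 + RtoC (/ 2))%C
    by (rewrite <- RtoC_plus; f_equal; lra).
  assert (H2 : (RtoC 2 * RtoC (/ 2))%C = RtoC 1) by (rewrite <- RtoC_mult; f_equal; lra).
  transitivity (2 * a 3%nat - a 2%nat * a 2%nat
    - (RtoC 2 * RtoC (/ 2)) * RtoC (/ 2) * (a 2%nat * a 2%nat))%C; [ring|rewrite H2; ring].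
Qed.

(** * Extremal functions *)

Lemma cpser_plus (a b : nat -> C) (z : C) :
  disc_coeffs a -> disc_coeffs b -> in_disc z ->
  cpser (fun n => a n + b n)%C z = (cpser a z + cpser b z)%C.
Proof.
intros Ha Hb Hz; apply cpser_unique; [now apply disc_coeffs_plus|trivial|].
apply Cseries_ext with (fun n => a n * cpow z n + b n * cpow z n)%C; [intros n; ring|].
apply Cseries_plus; now apply cpser_correct.
Qed.

Lemma cpser_scal (c : C) (a : nat -> C) (z : C) :
  disc_coeffs a -> in_disc z -> cpser (fun n => c * a n)%C z = (c * cpser a z)%C.
Proof.
intros Ha Hz; apply cpser_unique; [now apply disc_coeffs_scal|trivial|].
apply Cseries_ext with (fun n => c * (a n * cpow z n))%C; [intros n; ring|].
apply Cseries_scal; now apply cpser_correct.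
Qed.

Lemma cpser_ext (a b : nat -> C) (z : C) :
  (forall n, a n = b n) -> cpser a z = cpser b z.
Proof.
intros E; unfold cpser; f_equal; apply Series_ext; intros n; now rewrite E.
Qed.

(* Given a Schwarz function [W], integrate [f' / f = (phi_ch W) / z]: [f = z exp P]
   with [z P' = phi_ch W - 1]. *)
Lemma exists_Sstar_ch (W : nat -> C) :
  disc_coeffs W -> W 0%nat = RtoC 0 ->
  (forall z, in_disc z -> Cmod (cpser W z) < 1) ->
  exists (f : C -> C) (a : nat -> C), in_Sstar_ch f a /\
    a 2%nat = W 1%nat /\
    (RtoC 2 * a 3%nat - RtoC (3 / 2) * (a 2%nat * a 2%nat))%C = W 2%nat.
Proof.
intros HW W0 HWb.
(* The exponentials of [W] and [V = - W] have coefficients [A] and [B]; their half-sum is the [cosh]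
   part of [Q], the series of [phi_ch] composed with the Schwarz function. *)
set (V := fun n => (- (1) * W n)%C).
assert (HV : disc_coeffs V) by now apply disc_coeffs_scal.
set (A := ode_coeffs (deriv_coeffs W)); set (B := ode_coeffs (deriv_coeffs V)).
assert (HA : disc_coeffs A) by now apply disc_coeffs_ode, disc_coeffs_deriv.
assert (HB : disc_coeffs B) by now apply disc_coeffs_ode, disc_coeffs_deriv.
assert (HAB : disc_coeffs (fun n => A n + B n)%C) by now apply disc_coeffs_plus.
set (Q := fun n => (W n + RtoC (/ 2) * (A n + B n))%C).
assert (HQ : disc_coeffs Q) by now apply disc_coeffs_plus, disc_coeffs_scal.
assert (EQ : forall z, in_disc z -> cpser Q z = phi_ch (cpser W z)).
{ intros z Hz; unfold Q.
  rewrite (cpser_plus W (fun n => RtoC (/ 2) * (A n + B n))%C), (cpser_scal (RtoC (/ 2)) (fun n => A n + B n)%C),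
    (cpser_plus A B) by (trivial; now apply disc_coeffs_scal).
  unfold A, B; rewrite !cexp_cpser; trivial;
    [|unfold V; rewrite W0; ring].
  unfold V; rewrite cpser_scal by trivial.
  unfold phi_ch, ccosh; rewrite (Cmult_comm (RtoC (/ 2))); repeat f_equal; ring. }
assert (Q0 : Q 0%nat = RtoC 1).
{ unfold Q, A, B, ode_coeffs; simpl; rewrite W0.
  rewrite Cplus_0_l, <- RtoC_plus, <- RtoC_mult; f_equal; lra. }
(* Integrating [(Q - 1) / z] term by term divides the coefficient of [z^n] by [n]. *)
set (P := fun n => match n with O => RtoC 0 | S k => (RtoC (/ INR (S k)) * Q (S k))%C end).
assert (HP : disc_coeffs P).
{ apply disc_coeffs_le with Q; trivial; intros [|n]; unfold P.
  - rewrite Cmod_0; apply Cmod_ge_0.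
  - assert (N : 1 <= INR (S n)) by (rewrite S_INR; assert (N := pos_INR n); lra).
    rewrite Cmod_mult, Cmod_R, Rabs_pos_eq by (left; apply Rinv_0_lt_compat; lra).
    assert (N' : / INR (S n) <= 1) by (rewrite <- Rinv_1; apply Rinv_le_contravar; lra).
    assert (PQ := Cmod_ge_0 (Q (S n))); nra. }
set (p := deriv_coeffs P).
assert (Ep : forall z, in_disc z -> (z * cpser p z)%C = (cpser Q z - 1)%C).
{ intros z Hz; rewrite (cpser_shift Q), Q0 by trivial.
  rewrite (cpser_ext p (fun n => Q (S n))); [ring|].
  intros n; unfold p, deriv_coeffs, P.
  rewrite Cmult_assoc, <- RtoC_mult, Rinv_r, Cmult_1_l; trivial; apply not_0_INR; lia. }
set (F := ode_coeffs p).
assert (HF : disc_coeffs F) by now apply disc_coeffs_ode, disc_coeffs_deriv.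
assert (EF : forall z, in_disc z -> cpser F z = cexp (cpser P z))
  by (intros z Hz; now apply cexp_cpser).
set (a := fun n => match n with O => RtoC 0 | S k => F k end).
assert (Ha : disc_coeffs a) by now apply disc_coeffs_unshift.
set (f := fun z => (z * cexp (cpser P z))%C).
assert (Ef : forall z, in_disc z -> cpser a z = f z).
{ intros z Hz; rewrite cpser_shift by trivial; unfold f; rewrite <- EF by trivial.
  simpl; change (fun n => F n) with F; ring. }
assert (Hfa : forall z, in_disc z -> Cseries (fun n => a n * cpow z n)%C (f z))
  by (intros z Hz; rewrite <- Ef by trivial; now apply cpser_correct).
assert (HfA : in_A_with_coeffs f a) by (split; [|split]; trivial).
assert (Hf0 : forall z, in_disc z -> z <> RtoC 0 -> f z <> RtoC 0)
  by (intros z _ Hz; apply Cmult_neq_0; [trivial|apply cexp_neq_0]).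
assert (w0 : cpser W 0 = RtoC 0) by (rewrite cpser_0; trivial).
assert (Hq : forall z, in_disc z -> Sch_quotient f z = phi_ch (cpser W z)).
{ intros z Hz; unfold Sch_quotient; destruct (Req_EM_T (Cmod z) 0) as [E|E].
  - apply Cmod_eq_0 in E; rewrite E, <- EQ, cpser_0 by (trivial; apply in_disc_0).
    now rewrite Q0.
  - assert (Hz0 : z <> RtoC 0) by (intros E'; apply E; rewrite E'; apply Cmod_0).
    rewrite (is_C_derive_unique f z (1 * cexp (cpser P z)
      + z * (cpser p z * cexp (cpser P z)))%C).
    + rewrite <- EQ by trivial.
      replace (1 * cexp (cpser P z) + z * (cpser p z * cexp (cpser P z)))%C
        with ((1 + z * cpser p z) * cexp (cpser P z))%C by ring.
      rewrite Ep by trivial; unfold f; field; split; [apply cexp_neq_0|trivial].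
    + apply (has_cderiv_mult (fun z => z) (fun z => cexp (cpser P z))); [apply has_cderiv_id|].
      apply (has_cderiv_comp cexp (cpser P)); [apply has_cderiv_cexp|].
      now apply has_cderiv_cpser. }
exists f, a; split.
{ split; [exact HfA|split; [exact Hf0|]].
  exists (cpser W); repeat split; trivial.
  intros z Hz; eexists; now apply has_cderiv_cpser. }
(* The coefficients of [f] are not computed from the recurrence: the general expansion applied to
   [f] gives the limit in terms of [a], the series [W] gives it as [W 2], and limits are unique. *)
assert (D0 := has_cderiv_cpser W 0 HW in_disc_0).
rewrite cpser_0 in D0 by now apply disc_coeffs_deriv.
destruct (schwarz_function_expansion f (cpser W) a _ HfA Hf0 D0 w0 Hq) as [C1 C2].
assert (E1 : deriv_coeffs W 0 = W 1%nat) by (unfold deriv_coeffs; simpl; ring).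
rewrite E1 in C1, C2; split; [now symmetry|].
apply (tends0_unique _ _ _ C2).
assert (HW1 := disc_coeffs_shift _ HW).
apply tends0_ext with (cpser (fun n => W (S (S n)))).
- exists 1; split; [lra|]; intros z Hz0 Hz.
  rewrite (cpser_shift W), (cpser_shift (fun n => W (S n))), W0 by trivial.
  field; trivial.
- apply (tends0_cpser (fun n => W (S (S n)))), (disc_coeffs_shift _ HW1).
Qed.

Definition blaschke_coeffs (c : R) (n : nat) : C :=
  match n with
  | O => RtoC 0
  | S O => RtoC c
  | S (S k) => RtoC ((1 - c * c) * (- c) ^ k)
  end.

(* The series of [z (z + c) / (1 + c z) = c z + (1 - c^2) z^2 / (1 + c z)]. *)
Lemma blaschke_schwarz (c : R) :
  0 <= c < 1 -> disc_coeffs (blaschke_coeffs c) /\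
  forall z, in_disc z -> Cmod (cpser (blaschke_coeffs c) z) < 1.
Proof.
intros Hc.
assert (HW : disc_coeffs (blaschke_coeffs c)).
{ assert (B : forall n, Cmod (blaschke_coeffs c n) <= 1).
  { intros [|[|n]]; unfold blaschke_coeffs; rewrite Cmod_R.
    - rewrite Rabs_R0; lra.
    - rewrite Rabs_pos_eq; lra.
    - rewrite Rabs_mult, <- RPow_abs, Rabs_Ropp, (Rabs_pos_eq c), Rabs_pos_eq by nra.
      assert (0 <= c ^ n) by (apply pow_le; lra).
      assert (c ^ n <= 1) by (rewrite <- (pow1 n); apply pow_incr; lra); nra. }
  intros r Hr; exists 1; intros n; rewrite <- (Rmult_1_l 1).
  apply Rmult_le_compat; [apply Cmod_ge_0|apply pow_le; lra|apply B|].
  rewrite <- (pow1 n); apply pow_incr; lra. }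
split; [exact HW|]; intros z Hz.
assert (HW1 := disc_coeffs_shift _ HW); assert (HW2 := disc_coeffs_shift _ HW1).
rewrite cpser_shift, (cpser_shift (fun n => blaschke_coeffs c (S n))) by trivial.
set (k := fun n => blaschke_coeffs c (S (S n))) in *.
(* The tail is geometric of ratio [- c z]; this fixed-point equation, that is
   [(1 + c z) K = 1 - c^2], sums it without division. *)
assert (EK : cpser k z = (RtoC (1 - c * c) + z * (RtoC (- c) * cpser k z))%C).
{ rewrite cpser_shift at 1 by trivial.
  rewrite <- (cpser_scal (RtoC (- c)) k) by trivial.
  assert (E0 : k 0%nat = RtoC (1 - c * c)) by (unfold k, blaschke_coeffs; f_equal; simpl; ring).
  rewrite E0; do 2 f_equal; apply cpser_ext; intros n; unfold k, blaschke_coeffs.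
  rewrite <- RtoC_mult; f_equal; simpl; ring. }
change (fun n => blaschke_coeffs c (S (S n))) with k.
set (K := cpser k z) in *; simpl (blaschke_coeffs c _).
assert (N1 : (fst z ^ 2 + snd z ^ 2 < 1)).
{ rewrite <- Cmod_sqr; unfold in_disc in Hz; assert (P := Cmod_ge_0 z); nra. }
assert (E : ((1 + RtoC c * z) * (RtoC c + z * K))%C = (z + RtoC c)%C).
{ assert (EK' : ((1 + RtoC c * z) * K)%C = RtoC (1 - c * c)).
  { rewrite RtoC_opp in EK; set (g := RtoC c) in *.
    transitivity (K + g * z * K)%C; [ring|]; rewrite EK at 1; ring. }
  rewrite RtoC_minus, RtoC_mult in EK'; set (g := RtoC c) in *.
  transitivity ((1 + g * z) * g + z * ((1 + g * z) * K))%C; [ring|rewrite EK'; ring]. }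
(* The difference of the squared moduli is [(1 - c^2) (1 - |z|^2)]. *)
assert (M : Cmod (z + RtoC c) <= Cmod (1 + RtoC c * z)).
{ apply Rsqr_incr_0; [|apply Cmod_ge_0..].
  unfold Rsqr; rewrite !Cmod_sqr.
  assert (0 <= (1 - c * c) * (1 - (fst z ^ 2 + snd z ^ 2))) by (apply Rmult_le_pos; nra).
  simpl in *; lra. }
assert (Pc : 0 < Cmod (1 + RtoC c * z)).
{ assert (T := Cmod_triangle (1 + RtoC c * z) (- (RtoC c * z))).
  replace (1 + RtoC c * z + - (RtoC c * z))%C with (RtoC 1) in T
    by (set (g := RtoC c); ring).
  rewrite Cmod_1, Cmod_opp, Cmod_mult, Cmod_R, Rabs_pos_eq in T by lra.
  unfold in_disc in Hz; assert (P := Cmod_ge_0 z); nra. }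
rewrite <- E, Cmod_mult in M.
assert (M1 : Cmod (RtoC c + z * K) <= 1) by (apply Rmult_le_reg_l with (1 := Pc); lra).
(* Strictness comes from the outer factor [z]; the other factor is bounded by 1. *)
rewrite Cplus_0_l, Cmod_mult; unfold in_disc in Hz.
assert (P := Cmod_ge_0 z); nra.
Qed.

(** * Moduli of the logarithmic inverse coefficients and their sharp difference bounds *)

Lemma Cmod_Gamma1 (a : nat -> C) : Cmod (Gamma1 a) = Cmod (a 2%nat) / 2.
Proof.
unfold Gamma1; rewrite Cmod_mult, Cmod_R, Rabs_Ropp, Rabs_pos_eq by lra; field.
Qed.

(** The two equal products are left uncombined so that the first bracket is [c2] and the last term
    is [(3/2) c1^2], with [c1 = a2]. *)
Lemma Cmod_Gamma2 (a : nat -> C) :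
  Cmod (Gamma2 a) = Cmod ((RtoC 2 * a 3%nat - RtoC (3 / 2) * (a 2%nat * a 2%nat))
     - RtoC (3 / 2) * (a 2%nat * a 2%nat)) / 4.
Proof.
unfold Gamma2.
replace (RtoC 2 * a 3%nat - RtoC (3 / 2) * (a 2%nat * a 2%nat)
  - RtoC (3 / 2) * (a 2%nat * a 2%nat))%C
  with (RtoC 2 * (a 3%nat - RtoC (3 / 2) * (a 2%nat * a 2%nat)))%C
  by (set (g := RtoC (3 / 2)); ring).
rewrite !Cmod_mult, !Cmod_R, Rabs_Ropp, !Rabs_pos_eq by lra; field.
Qed.

Theorem theorem4p2 :
  (forall (f : C -> C) (a : nat -> C), in_Sstar_ch f a ->
     - / sqrt 10 <= Cmod (Gamma2 a) - Cmod (Gamma1 a) <= / 4) /\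
  (exists (f : C -> C) (a : nat -> C), in_Sstar_ch f a /\
     Cmod (Gamma2 a) - Cmod (Gamma1 a) = / 4) /\
  (exists (f : C -> C) (a : nat -> C), in_Sstar_ch f a /\
     Cmod (Gamma2 a) - Cmod (Gamma1 a) = - / sqrt 10).
Proof.
set (s := / sqrt 10).
assert (H10 : 0 < sqrt 10) by (apply sqrt_lt_R0; lra).
assert (Hs0 : 0 < s) by now apply Rinv_0_lt_compat.
assert (Hs2 : s * s = 1 / 10).
{ unfold s; rewrite <- Rinv_mult, sqrt_sqrt; lra. }
split; [|split].
- intros f a [HA [Hf0 [w [Hw [w0 [Hwb Hq]]]]]].
  destruct (Hw 0%C in_disc_0) as [c1 Hc1].
  destruct (schwarz_function_expansion f w a c1 HA Hf0 Hc1 w0 Hq) as [E1 E2].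
  assert (B := schwarz_second_coeff w _ _ Hw (fun z Hz => Rlt_le _ _ (Hwb z Hz)) E2).
  rewrite E1 in B; rewrite Cmod_Gamma1, Cmod_Gamma2.
  set (c2 := (RtoC 2 * a 3%nat - RtoC (3 / 2) * (a 2%nat * a 2%nat))%C) in *.
  set (d := (RtoC (3 / 2) * (a 2%nat * a 2%nat))%C).
  assert (Ed : Cmod d = 3 / 2 * (Cmod (a 2%nat) * Cmod (a 2%nat)))
    by (unfold d; rewrite !Cmod_mult, Cmod_R, Rabs_pos_eq; lra).
  assert (T1 := Cmod_triangle c2 (- d)); rewrite Cmod_opp in T1.
  assert (T2 := Cmod_triangle c2 (- (c2 - d))); rewrite Cmod_opp in T2.
  replace (c2 + - (c2 - d))%C with d in T2 by ring.
  change (c2 + - d)%C with (c2 - d)%C in T1; rewrite Ed in *.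
  assert (P0 := Cmod_ge_0 (c2 - d)); assert (P1 := Cmod_ge_0 c2).
  assert (P2 := Cmod_ge_0 (a 2%nat)).
  set (x := Cmod (a 2%nat)) in *.
  assert (Hx : x <= 1) by nra.
  (* The upper bound is [(1 + x^2 / 2) / 4 - x / 2 <= 1 / 4], valid for [0 <= x <= 1]. *)
  split; [|nra].
  (* For [x <= 2 s], [|Gamma2| >= 0] is enough. Beyond, [(5 x^2 / 2 - 1) / 4 - x / 2] takes the
     value [- s] at [x = 2 s] and increases, because [2 s] lies to the right of its vertex
     [2 / 5]. *)
  destruct (Rle_lt_dec x (2 * s)) as [Hxs|Hxs]; [lra|].
  assert (1 / 5 < s) by nra.
  nra.
- destruct (blaschke_schwarz 0 ltac:(lra)) as [HW HB].
  destruct (exists_Sstar_ch _ HW eq_refl HB) as [f [a [Hf [E1 E2]]]].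
  exists f, a; split; [exact Hf|].
  rewrite Cmod_Gamma1, Cmod_Gamma2, E2, E1; simpl.
  replace ((1 - 0 * 0) * 1) with 1 by ring.
  rewrite !Cmult_0_r, Cmod_0.
  replace (1 - 0)%C with (RtoC 1) by ring; rewrite Cmod_1; lra.
- assert (Hc : 0 <= 2 * s < 1) by (split; nra).
  destruct (blaschke_schwarz (2 * s) Hc) as [HW HB].
  destruct (exists_Sstar_ch _ HW eq_refl HB) as [f [a [Hf [E1 E2]]]].
  exists f, a; split; [exact Hf|].
  rewrite Cmod_Gamma1, Cmod_Gamma2, E2, E1; simpl.
  rewrite <- !RtoC_mult, <- RtoC_minus, !Cmod_R.
  (* With [c = 2 s] one has [c^2 = 2 / 5], so [c2 = 1 - c^2 = 3 / 5 = (3/2) c^2]: [Gamma2] vanishes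
     and [|Gamma1| = s]. *)
  replace ((1 - 2 * s * (2 * s)) * 1 - 3 / 2 * (2 * s * (2 * s))) with 0 by lra.
  rewrite Rabs_R0, Rabs_pos_eq; lra.
Qed.
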